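(* Let $\Phi(t)$ be the fundamental matrix, with $\Phi(0)=I$, of the linear cyclic negative feedback system $$\dot x_1=a_{11}(t)x_1+a_{1n}(t)x_n,\qquad \dot x_i=a_{i,i-1}(t)x_{i-1}+a_{ii}(t)x_i,\quad 2\le i\le n,$$ whose coefficients are continuous on $\mathbb{R}$ and satisfy $a_{1n}(t)<0$ and $a_{i,i-1}(t)>0$ for $2\le i\le n$ and all $t\in\mathbb{R}$. Then for any fixed $t>0$ there exist subspaces $W_h$, $h=1,2,\dots,\frac{\tilde n+1}{2}$, of $\mathbb{R}^n$, invariant with respect to $\Phi(t)$, such that $\dim W_h=2$ for $h=1,\dots,\frac{\tilde n-1}{2}$, $$\dim W_{\frac{\tilde n+1}{2}}=\begin{cases}2 & \text{if } n=\tilde n+1 \text{ is even},\\ 1& \text{if } n=\tilde n \text{ is odd},\end{cases}$$ and $$\mathbb{R}^n=W_1\oplus W_2\oplus\cdots\oplus W_{\frac{\tilde n+1}{2}}.$$ If $x\in W_i\setminus\{0\}$, then $x\in\mathcal{N}$ and $N(x)=2i-1$, for $i=1,\dots,\frac{\tilde n+1}{2}$. If $x\ne0$ and $x\in W_h\oplus W_{h+1}\oplus\cdots\oplus W_k$ (where $1\le h\le k\le\frac{\tilde n+1}{2}$), then $N_m(x)\ge 2h-1$ and $N_M(x)\le 2k-1$. Moreover, if $\nu_i$ and $\mu_i$ denote the minimum and the maximum modulus of the eigenvalues of the restriction of $\Phi(t)$ to $W_i$, then $$\mu_1\ge\nu_1>\mu_2\ge\nu_2>\cdots>\mu_{\frac{\tilde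 n+1}{2}}\ge\nu_{\frac{\tilde n+1}{2}}.$$
   Context: Here $n\ge2$; $\tilde n=n$ if $n$ is odd and $\tilde n=n-1$ if $n$ is even. Put $\delta_1=-1$, $\delta_i=1$ for $2\le i\le n$, and $x_0:=x_n$. On $\Lambda=\{x\in\mathbb{R}^n: x_i\ne0,\ i=1,\dots,n\}$ define $N(x)=\mathrm{card}\{i\in\{1,\dots,n\}:\delta_i x_ix_{i-1}<0\}$; it takes values in $\{1,3,\dots,\tilde n\}$. For $x\in\mathbb{R}^n$, let $N_m(x)$ and $N_M(x)$ be the minimum and maximum of $N(x')$ over $x'\in\mathcal{U}\cap\Lambda$, where $\mathcal{U}$ is a sufficiently small neighborhood of $x$. Let $\mathcal{N}=\{x\in\mathbb{R}^n:N_m(x)=N_M(x)\}$, and extend $N$ to $\mathcal{N}$ by $N(x)=N_m(x)=N_M(x)$. *)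

(* Defs.v *)
From HB Require Import structures.
From mathcomp Require Export all_boot all_order all_algebra.
From mathcomp Require Export all_classical all_reals all_analysis.
From mathcomp Require Export complex.
Export Order.TTheory GRing.Theory Num.Theory.
Export numFieldNormedType.Exports.

#[export] Set Implicit Arguments.
#[export] Unset Strict Implicit.
#[export] Unset Printing Implicit Defensive.

Local Open Scope classical_set_scope.
Local Open Scope ring_scope.

(* Coordinates are numbered from 0: the mathematical index i in {1, .., n} is
   the ordinal of value i - 1.  The cyclic predecessor i - 1 (with the
   convention x_0 = x_n) is [ord_pred i].  A vector of R^n is a row vector
   [x : 'rV[R]_n], so that subspaces are row spaces of matrices. *)

Definition ntilde (n : nat) : nat := if odd n then n else n.-1.

Definition delta (R : realType) (n : nat) (i : 'I_n) : R :=
  if (i : nat) == 0%N then -1 else 1.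

Definition Lambda (R : realType) (n : nat) : set 'rV[R]_n :=
  [set x | forall i, x 0 i != 0].

Definition signN (R : realType) (n : nat) (x : 'rV[R]_n) : nat :=
  #|[pred i : 'I_n | delta R i * x 0 i * x 0 (ord_pred i) < 0]|.

Definition signN_values (R : realType) (n : nat) (U : set 'rV[R]_n) : set nat :=
  [set signN x | x in U `&` @Lambda R n].

Definition is_minimum (A : set nat) (k : nat) : Prop :=
  A k /\ forall l, A l -> (k <= l)%N.

Definition is_maximum (A : set nat) (k : nat) : Prop :=
  A k /\ forall l, A l -> (l <= k)%N.

Definition is_Nm (R : realType) (n : nat) (x : 'rV[R]_n) : set nat :=
  [set k | exists2 U0 : set 'rV[R]_n, nbhs x U0 &
     forall U, nbhs x U -> U `<=` U0 -> is_minimum (signN_values U) k].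

Definition is_NM (R : realType) (n : nat) (x : 'rV[R]_n) : set nat :=
  [set k | exists2 U0 : set 'rV[R]_n, nbhs x U0 &
     forall U, nbhs x U -> U `<=` U0 -> is_maximum (signN_values U) k].

(* The default value 0 is never used: see [NmP], [NMP] below. *)
Definition Nm (R : realType) (n : nat) (x : 'rV[R]_n) : nat :=
  xget 0%N (is_Nm x).
Definition NM (R : realType) (n : nat) (x : 'rV[R]_n) : nat :=
  xget 0%N (is_NM x).

Definition calN (R : realType) (n : nat) : set 'rV[R]_n :=
  [set x | Nm x = NM x].

(* The extension of [signN] from Lambda to calN; meaningful on calN only. *)
Definition extN (R : realType) (n : nat) (x : 'rV[R]_n) : nat := Nm x.

(* a i j is the coefficient a_{ij}; only a i i and a i (ord_pred i) are used.
   For i of value 0, a i (ord_pred i) is a_{1n}. *)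
Definition cyclic_negative_feedback (R : realType) (n : nat)
    (a : 'I_n -> 'I_n -> R -> R) : Prop :=
  [/\ forall i, continuous (a i i),
      forall i, continuous (a i (ord_pred i)),
      forall (i : 'I_n) t, (i : nat) = 0%N -> a i (ord_pred i) t < 0 &
      forall (i : 'I_n) t, (0 < i)%N -> 0 < a i (ord_pred i) t].

Definition solves_cyclic_system (R : realType) (n : nat)
    (a : 'I_n -> 'I_n -> R -> R) (x : R -> 'cV[R]_n) : Prop :=
  forall (t : R) (i : 'I_n),
    is_derive t 1 (fun s => x s i 0)
      (a i (ord_pred i) t * x t (ord_pred i) 0 + a i i t * x t i 0).

Definition fundamental_matrix (R : realType) (n : nat)
    (a : 'I_n -> 'I_n -> R -> R) (Phi : R -> 'M[R]_n) : Prop :=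
  Phi 0 = 1%:M /\
  forall j : 'I_n, solves_cyclic_system a (fun t => col j (Phi t)).

(* Moduli of the complex eigenvalues of a real square matrix; the modulus
   [`|l|] in R[i] is the embedding of a real number. *)
Definition is_min_modulus (R : realType) (m : nat) (M : 'M[R]_m) (r : R) :=
  (exists2 l : R[i], eigenvalue (map_mx (real_complex R) M) l
                     & `|l| = real_complex R r) /\
  (forall l : R[i], eigenvalue (map_mx (real_complex R) M) l ->
                    real_complex R r <= `|l|).

Definition is_max_modulus (R : realType) (m : nat) (M : 'M[R]_m) (r : R) :=
  (exists2 l : R[i], eigenvalue (map_mx (real_complex R) M) l
                     & `|l| = real_complex R r) /\
  (forall l : R[i], eigenvalue (map_mx (real_complex R) M) l ->
                    `|l| <= real_complex R r).

Lemma Lambda_dense (R : realType) (n : nat) (x : 'rV[R]_n) U :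
  nbhs x U -> (U `&` @Lambda R n) !=set0.
Proof.
case=> P xP PU.
have Pnz i j : exists2 y, P i j y & y != 0.
  have := xP i j; case: (eqVneq (x i j) 0) => [->|nz] nP; last first.
    by exists (x i j) => //; exact: (nbhs_singleton nP).
  have /nbhs_ballP[e /= e0 Pe] := nP.
  exists (e / 2); last by rewrite gt_eqF// divr_gt0.
  apply: Pe; rewrite /ball /= sub0r normrN gtr0_norm ?divr_gt0//.
  by rewrite ltr_pdivrMr// ltr_pMr// ltr1n.
exists (\matrix_(i, j) s2val (cid2 (Pnz i j))); split.
  by apply: PU => i j; rewrite mxE; case: cid2.
by move=> i; rewrite mxE; case: cid2.
Qed.

Lemma signN_values_neq0 (R : realType) (n : nat) (x : 'rV[R]_n) U :
  nbhs x U -> signN_values U !=set0.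
Proof. by move=> /Lambda_dense[y Uy]; exists (signN y), y. Qed.

Lemma signN_values_le (R : realType) (n : nat) (U : set 'rV[R]_n) l :
  signN_values U l -> (l <= n)%N.
Proof. by case=> y _ <-; rewrite (leq_trans (max_card _))// card_ord. Qed.

Lemma signN_valuesS (R : realType) (n : nat) (U V : set 'rV[R]_n) :
  U `<=` V -> signN_values U `<=` signN_values V.
Proof. by move=> UV _ [y [Uy Ly] <-]; exists y => //; split => //; exact: UV. Qed.

Lemma NmP (R : realType) (n : nat) (x : 'rV[R]_n) : is_Nm x (Nm x).
Proof.
apply: xgetPex.
pose P k := `[< exists2 U : set 'rV[R]_n, nbhs x U &
                 forall l, signN_values U l -> (k <= l)%N >].
have exP : exists k, P k by exists 0%N; apply/asboolP; exists setT; first exact: filterT.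
have leP k : P k -> (k <= n)%N.
  move=> /asboolP[U xU kU]; have [l Ul] := signN_values_neq0 xU.
  by rewrite (leq_trans (kU _ Ul))// (signN_values_le Ul).
case: (ex_maxnP exP leP) => k /asboolP[U0 xU0 kU0] kmax.
exists k; exists U0 => // U xU UU0; split; last first.
  by move=> l /(signN_valuesS UU0)/kU0.
apply: contrapT => nk; suff /kmax : P k.+1 by rewrite ltnn.
apply/asboolP; exists U => // l Ul.
rewrite ltn_neqAle (kU0 _ (signN_valuesS UU0 Ul)) andbT.
by apply/eqP => kl; apply: nk; rewrite kl.
Qed.

Lemma NMP (R : realType) (n : nat) (x : 'rV[R]_n) : is_NM x (NM x).
Proof.
apply: xgetPex.
pose P k := `[< exists2 U : set 'rV[R]_n, nbhs x U &
                 forall l, signN_values U l -> (l <= k)%N >].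
have exP : exists k, P k.
  exists n; apply/asboolP; exists setT; first exact: filterT.
  by move=> l /signN_values_le.
case: (ex_minnP exP) => k /asboolP[U0 xU0 kU0] kmin.
exists k; exists U0 => // U xU UU0; split; last first.
  by move=> l /(signN_valuesS UU0)/kU0.
apply: contrapT => nk.
have ltk l : signN_values U l -> (l < k)%N.
  move=> Ul; rewrite ltn_neqAle (kU0 _ (signN_valuesS UU0 Ul)) andbT.
  by apply/eqP => kl; apply: nk; rewrite -kl.
have [l0 /ltk l0k] := signN_values_neq0 xU.
suff /kmin : P k.-1 by rewrite leqNgt ltn_predL (leq_ltn_trans _ l0k).
apply/asboolP; exists U => // l /ltk lk.
by rewrite -ltnS prednK// (leq_ltn_trans _ l0k).
Qed.

Lemma Nm_unique (R : realType) (n : nat) (x : 'rV[R]_n) k :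
  is_Nm x k -> Nm x = k.
Proof.
case: (NmP x) => U xU minU [V xV minV].
have xUV : nbhs x (U `&` V) by exact: filterI.
have [a b] := minU _ xUV (@subIsetl _ U V).
have [c d] := minV _ xUV (@subIsetr _ U V).
by apply/eqP; rewrite eqn_leq b// d.
Qed.

Lemma NM_unique (R : realType) (n : nat) (x : 'rV[R]_n) k :
  is_NM x k -> NM x = k.
Proof.
case: (NMP x) => U xU maxU [V xV maxV].
have xUV : nbhs x (U `&` V) by exact: filterI.
have [a b] := maxU _ xUV (@subIsetl _ U V).
have [c d] := maxV _ xUV (@subIsetr _ U V).
by apply/eqP; rewrite eqn_leq b// d.
Qed.

Lemma signN_locally_constant (R : realType) (n : nat) (x : 'rV[R]_n) :
  Lambda x -> \forall y \near x, signN y = signN x.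
Proof.
move=> Lx; exists (fun i j => [set z | 0 < z * x i j]).
  move=> i j; have nz : 0 < x i j * x i j.
    by rewrite -expr2 exprn_even_gt0//= ord1 Lx.
  have : (fun z : R => z * x i j) @ x i j --> x i j * x i j.
    by apply: cvgM; [exact: cvg_id | exact: cvg_cst].
  by move=> /cvgr_gt/(_ _ nz).
move=> y /= xy; rewrite /signN; apply: eq_card => i; rewrite !inE -!mulrA.
have pos : 0 < (y 0 i * y 0 (ord_pred i)) * (x 0 i * x 0 (ord_pred i)).
  by rewrite mulrACA mulr_gt0 ?xy.
have [p|p|p] := ltgtP (x 0 i * x 0 (ord_pred i)) 0.
- have q : y 0 i * y 0 (ord_pred i) < 0 by rewrite -(nmulr_lgt0 _ p).
  by rewrite (nmulr_llt0 _ p) (nmulr_llt0 _ q).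
- have q : 0 < y 0 i * y 0 (ord_pred i) by rewrite -(pmulr_lgt0 _ p).
  by rewrite (pmulr_llt0 _ p) (pmulr_llt0 _ q).
- by move: pos; rewrite p mulr0 ltxx.
Qed.

Lemma signN_values_Lambda (R : realType) (n : nat) (x : 'rV[R]_n) :
  Lambda x -> exists2 U0 : set 'rV[R]_n, nbhs x U0 &
    forall U, nbhs x U -> U `<=` U0 -> signN_values U = [set signN x].
Proof.
move=> Lx; exists [set y | signN y = signN x]; first exact: signN_locally_constant.
move=> U xU UU0; apply/seteqP; split => [_ [y [/UU0 Uy _] <-]//|_ ->].
by exists x => //; split => //; exact: nbhs_singleton.
Qed.

Lemma Nm_Lambda (R : realType) (n : nat) (x : 'rV[R]_n) :
  Lambda x -> Nm x = signN x.
Proof.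
move=> /signN_values_Lambda[U0 xU0 cU0]; apply: Nm_unique.
by exists U0 => // U xU UU0; rewrite cU0//; split => // l ->.
Qed.

Lemma NM_Lambda (R : realType) (n : nat) (x : 'rV[R]_n) :
  Lambda x -> NM x = signN x.
Proof.
move=> /signN_values_Lambda[U0 xU0 cU0]; apply: NM_unique.
by exists U0 => // U xU UU0; rewrite cU0//; split => // l ->.
Qed.

(* Main.v *)
Require Import Defs.
From mathcomp Require Import lra ring zify.

(* Along a nonzero solution [x], the vector [x s] lies in [Lambda] for [s <> tau] close to
   [tau]: a coordinate vanishing at [tau] takes, just after [tau], the sign that creates no
   sign change with its cyclic predecessor and, just before [tau], the opposite one.  Hence
   [signN (x s)] is at most [Nm (x tau)] on the right of [tau] and at least [NM (x tau)] on
   the left, and [M := (Phi t)^T] satisfies [NM (x M) <= Nm x] for every [x != 0].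

   By compactness this inequality holds along pseudo-orbits of [M] as well.  If the
   eigenvalues of [M] involved in [x] have moduli [<= r] and those involved in [y] have moduli
   [>= r], then damping the forward orbit of [x] and the backward orbit of [y] slightly more
   than their growth rates yields a pseudo-orbit from near [x M] to near [y M^-1], and
   therefore [NM y <= Nm x].

   Consequently [N] is constant on each sum of generalized eigenspaces of equal modulus and
   does not increase with the modulus.  Grouping the eigenvalues by the value of [N] gives the
   [W i].  A subspace on which [N] is constant has dimension at most 2 (a nonzero vector with
   two consecutive zero coordinates is not in [calN]), and at most 1 where [N = n]; as the
   dimensions add up to [n], all these bounds are attained. *)

Local Open Scope classical_set_scope.
Local Open Scope ring_scope.

(** * Sign changes *)

Section SignChanges.
Variables (R : realType) (n : nat).
Implicit Types x y z : 'rV[R]_n.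

Lemma delta_neq0 (i : 'I_n) : delta R i != 0.
Proof. by rewrite /delta; case: ifP => _; rewrite ?oppr_eq0 oner_eq0. Qed.

Lemma Nm_attained x U : nbhs x U ->
  exists y, [/\ U y, Lambda y & signN y = Nm x].
Proof.
move=> xU; have [V xV minV] := NmP x.
have [[y [[Uy _] Ly] <-] _] := minV _ (filterI xU xV) (@subIsetr _ U V).
by exists y.
Qed.

Lemma NM_attained x U : nbhs x U ->
  exists y, [/\ U y, Lambda y & signN y = NM x].
Proof.
move=> xU; have [V xV maxV] := NMP x.
have [[y [[Uy _] Ly] <-] _] := maxV _ (filterI xU xV) (@subIsetr _ U V).
by exists y.
Qed.

Lemma near_signN x : \forall y \near x,
  Lambda y -> (Nm x <= signN y <= NM x)%N.
Proof.
have [U xU minU] := NmP x; have [V xV maxV] := NMP x.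
near=> y => Ly; apply/andP; split.
  by apply: (minU U xU _).2 => //; exists y => //; split => //; near: y.
by apply: (maxV V xV _).2 => //; exists y => //; split => //; near: y.
Unshelve. all: by end_near. Qed.

(** Semicontinuity: points near [y] are also near [x] once [y] is close to [x], so the sign counts
    seen from [y] are among those seen from [x]. *)
Lemma near_Nm_NM x : \forall y \near x, (Nm x <= Nm y)%N /\ (NM y <= NM x)%N.
Proof.
have /nbhs_interior := near_signN x; apply: filterS => y yU; split.
  by have [z [zU Lz <-]] := Nm_attained yU; have /andP[] := zU Lz.
by have [z [zU Lz <-]] := NM_attained yU; have /andP[] := zU Lz.
Qed.

Lemma Nm_le_NM x : (Nm x <= NM x)%N.
Proof.
have [y [yU Ly _]] := Nm_attained (near_signN x).
by have /andP[] := yU Ly; exact: leq_trans.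
Qed.

Lemma closed_Nm_le k : closed [set x : 'rV[R]_n | (Nm x <= k)%N].
Proof.
rewrite -(setCK [set x | _]); apply: open_closedC.
rewrite openE => x /= /negP; rewrite -ltnNge => kx.
by have := near_Nm_NM x; apply: filterS => y [xy _] /=; apply/negP; lia.
Qed.

Lemma closed_NM_ge k : closed [set x : 'rV[R]_n | (k <= NM x)%N].
Proof.
rewrite -(setCK [set x | _]); apply: open_closedC.
rewrite openE => x /= /negP; rewrite -ltnNge => kx.
by have := near_Nm_NM x; apply: filterS => y [_ xy] /=; apply/negP; lia.
Qed.

Lemma LambdaZ (c : R) x : c != 0 -> Lambda x -> Lambda (c *: x).
Proof. by move=> c0 Lx i; rewrite mxE mulf_neq0. Qed.

Lemma signNZ (c : R) x : c != 0 -> signN (c *: x) = signN x.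
Proof.
move=> c0; apply: eq_card => i; rewrite !inE !mxE.
rewrite (_ : _ * _ * _ = c ^+ 2 * (delta R i * x 0 i * x 0 (ord_pred i))).
  by rewrite pmulr_rlt0// exprn_even_gt0.
by ring.
Qed.

Lemma nbhsZ (c : R) x U : nbhs (c *: x) U -> nbhs x [set y | U (c *: y)].
Proof.
have : (fun y : 'rV[R]_n => c *: y) @ x --> c *: x by exact: scaler_continuous.
by move=> /(_ U).
Qed.

(** Scaling carries neighborhoods of [x] to neighborhoods of [c *: x] and keeps sign counts;
    applying this to [c^-1] as well gives the equalities below. *)
Lemma Nm_NM_Zle (c : R) x : c != 0 ->
  (Nm (c *: x) <= Nm x)%N /\ (NM x <= NM (c *: x))%N.
Proof.
move=> c0; have xU := nbhsZ (near_signN (c *: x)); split.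
  have [y [yU Ly <-]] := Nm_attained xU.
  by rewrite -(signNZ y c0); have /andP[] := yU (LambdaZ c0 Ly).
have [y [yU Ly <-]] := NM_attained xU.
by rewrite -(signNZ y c0); have /andP[] := yU (LambdaZ c0 Ly).
Qed.

Lemma NmZ (c : R) x : c != 0 -> Nm (c *: x) = Nm x.
Proof.
move=> c0; have [le1 _] := Nm_NM_Zle x c0.
have [] := @Nm_NM_Zle c^-1 (c *: x); first by rewrite invr_eq0.
by rewrite scalerA mulVf// scale1r; lia.
Qed.

Lemma NMZ (c : R) x : c != 0 -> NM (c *: x) = NM x.
Proof.
move=> c0; have [_ le1] := Nm_NM_Zle x c0.
have [] := @Nm_NM_Zle c^-1 (c *: x); first by rewrite invr_eq0.
by rewrite scalerA mulVf// scale1r; lia.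
Qed.

Lemma signN_le x : (signN x <= n)%N.
Proof. by rewrite (leq_trans (max_card _))// card_ord. Qed.

Lemma NM_le x : (NM x <= n)%N.
Proof. by have [y [_ _ <-]] := NM_attained (near_signN x); exact: signN_le. Qed.

Lemma sum_ord_pred (F : 'I_n -> nat) :
  (\sum_i F (ord_pred i) = \sum_i F i)%N.
Proof. by rewrite [RHS](reindex_inj (@ord_pred_inj n)). Qed.

Lemma signN_sum x :
  signN x = (\sum_i (delta R i * x 0 i * x 0 (ord_pred i) < 0)%R : nat)%N.
Proof. by rewrite /signN -sum1_card big_mkcond; apply: eq_bigr. Qed.

End SignChanges.

(* The product of the numbers [delta i * x_i * x_(i-1)] is [- (prod_i x_i)^2]. *)
Lemma odd_signN (R : realType) (n : nat) (x : 'rV[R]_n.+1) :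
  Lambda x -> odd (signN x).
Proof.
move=> Lx; set F := fun i => delta R i * x 0 i * x 0 (ord_pred i).
have F0 i : F i != 0 by rewrite !mulf_neq0 ?delta_neq0 ?Lx.
have sgF i : Num.sg (F i) = (-1) ^+ (F i < 0)%R.
  by rewrite sgr_def F0 mulr1n.
have prodF : \prod_i F i = - (\prod_i x 0 i) ^+ 2.
  have xpred : \prod_i x 0 (ord_pred i) = \prod_i x 0 i.
    by rewrite [RHS](reindex_inj (@ord_pred_inj n.+1)).
  rewrite /F !big_split/= xpred (_ : \prod_i delta R i = -1); first by ring.
  by rewrite big_ord_recl/= big1 ?mulr1//.
have : Num.sg (\prod_i F i) = -1.
  rewrite prodF sgrN gtr0_sg// exprn_even_gt0//=.
  by apply/prodf_neq0 => i _; exact: Lx.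
rewrite (big_morph _ (@sgrM R) (@sgr1 R)) (eq_bigr _ (fun i _ => sgF i)).
rewrite prodrXr -signN_sum -signr_odd.
by case: odd => // /eqP; rewrite expr0 -subr_eq0 opprK (pnatr_eq0 R 2).
Qed.

Lemma odd_Nm (R : realType) (n : nat) (x : 'rV[R]_n.+1) : odd (Nm x).
Proof.
by have [y [_ Ly <-]] := Nm_attained (near_signN x); exact: odd_signN.
Qed.

Lemma mulr_lt0_addb (R : realType) (u v : R) : u != 0 -> v != 0 ->
  (u * v < 0) = (u < 0) (+) (v < 0).
Proof. by move=> u0 v0; rewrite mulr_lt0 u0 v0. Qed.

Lemma mulr_gt0_addb (R : realType) (u v : R) : u != 0 -> v != 0 ->
  (0 < u * v) = ~~ ((u < 0) (+) (v < 0)).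
Proof.
by move=> u0 v0; rewrite -mulr_lt0_addb// ltNge le_eqVlt mulf_eq0 (negPf u0) (negPf v0).
Qed.

(** * Sign counts of vectors agreeing off the zeros of a given one *)

Section Comparison.
Variables (R : realType) (n : nat).
Implicit Types x y z : 'rV[R]_n.

(* With [e i := (z_i * y_i < 0)], the inequality holds termwise up to
   [e i - e (i - 1)], which sums to zero over the cycle. *)
Lemma signN_le_agree x y z : Lambda y -> Lambda z ->
  (forall i, x 0 i != 0 -> 0 < y 0 i * x 0 i) ->
  (forall i, x 0 i != 0 -> 0 < z 0 i * x 0 i) ->
  (forall i, x 0 i = 0 -> 0 < delta R i * (z 0 i * z 0 (ord_pred i))) ->
  (signN z <= signN y)%N.
Proof.
move=> Ly Lz xy xz z0; rewrite !signN_sum.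
pose e i := (z 0 i * y 0 i < 0 : nat).
rewrite -(leq_add2r (\sum_i e i)) -[in leqRHS](sum_ord_pred e) -!big_split/=.
apply: leq_sum => i _; rewrite /e {e}.
have d0 := delta_neq0 R i.
have [x0|x0] := eqVneq (x 0 i) 0.
  have := z0 _ x0.
  rewrite !(mulr_lt0_addb, mulr_gt0_addb) ?mulf_neq0 ?Ly ?Lz//.
  by do 5 case: (_ < 0).
have := xy _ x0; have := xz _ x0.
rewrite !(mulr_lt0_addb, mulr_gt0_addb) ?mulf_neq0 ?Ly ?Lz//.
by do 6 case: (_ < 0).
Qed.

(** Mirror image of [signN_le_agree]: the same cyclic correction [e] is used, and at a zero of [x]
    the vector [z] now has a sign change. *)
Lemma signN_ge_oppose x y z : Lambda y -> Lambda z ->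
  (forall i, x 0 i != 0 -> 0 < y 0 i * x 0 i) ->
  (forall i, x 0 i != 0 -> 0 < z 0 i * x 0 i) ->
  (forall i, x 0 i = 0 -> delta R i * (z 0 i * z 0 (ord_pred i)) < 0) ->
  (signN y <= signN z)%N.
Proof.
move=> Ly Lz xy xz z0; rewrite !signN_sum.
pose e i := (z 0 i * y 0 i < 0 : nat).
rewrite -(leq_add2r (\sum_i e i)) -[in leqRHS](sum_ord_pred e) -!big_split/=.
apply: leq_sum => i _; rewrite /e {e}.
have d0 := delta_neq0 R i.
have [x0|x0] := eqVneq (x 0 i) 0.
  have := z0 _ x0.
  rewrite !(mulr_lt0_addb, mulr_gt0_addb) ?mulf_neq0 ?Ly ?Lz//.
  by do 5 case: (_ < 0).
have := xy _ x0; have := xz _ x0.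
rewrite !(mulr_lt0_addb, mulr_gt0_addb) ?mulf_neq0 ?Ly ?Lz//.
by do 6 case: (_ < 0).
Qed.

Lemma near_agree x : \forall y \near x, forall i, x 0 i != 0 -> 0 < (y : 'rV[R]_n) 0 i * x 0 i.
Proof.
exists (fun i j => [set z | x i j != 0 -> 0 < z * x i j]); last first.
  by move=> y /= xy i; exact: xy.
move=> i j; have [->|x0] := eqVneq (x i j) 0; first by near=> z.
have : (fun z : R => z * x i j) @ x i j --> x i j * x i j.
  by apply: cvgM; [exact: cvg_id | exact: cvg_cst].
move=> /cvgr_gt/(_ 0) h; have {h} : \forall z \near x i j, 0 < z * x i j.
  by apply: h; rewrite -expr2 exprn_even_gt0.
by move=> h; apply: filterS h => z zx _.
Unshelve. all: by end_near. Qed.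

(** The minimum is attained at some [y] that agrees in sign with [x] off its zeros, and [z] is
    compared with that [y]. Hence [z] itself need not be near [x]. *)
Lemma signN_le_Nm x z : Lambda z ->
  (forall i, x 0 i != 0 -> 0 < z 0 i * x 0 i) ->
  (forall i, x 0 i = 0 -> 0 < delta R i * (z 0 i * z 0 (ord_pred i))) ->
  (signN z <= Nm x)%N.
Proof.
move=> Lz xz z0; have [y [xy Ly <-]] := Nm_attained (near_agree x).
exact: signN_le_agree xy xz z0.
Qed.

Lemma NM_le_signN x z : Lambda z ->
  (forall i, x 0 i != 0 -> 0 < z 0 i * x 0 i) ->
  (forall i, x 0 i = 0 -> delta R i * (z 0 i * z 0 (ord_pred i)) < 0) ->
  (NM x <= signN z)%N.
Proof.
move=> Lz xz z0; have [y [xy Ly <-]] := NM_attained (near_agree x).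
exact: signN_ge_oppose xy xz z0.
Qed.
End Comparison.

(** This allows the signs of a vector near [x] to be changed at zeros of [x] without losing the
    bounds [Nm x] and [NM x] on its sign count. *)
Lemma near_set_coord (R : realType) (n : nat) (x : 'rV[R]_n) (U : set 'rV[R]_n)
    (A : pred 'I_n) : nbhs x U -> (forall i, A i -> x 0 i = 0) ->
  \forall y \near x, exists2 e : R, 0 < e & forall s : 'I_n -> R,
    (forall i, `|s i| <= e) -> U (\row_j if A j then s j else (y : 'rV[R]_n) 0 j).
Proof.
move=> /nbhs_ballP[e /= e0 xU] xA0.
near=> y; exists (e / 2); first by rewrite divr_gt0.
move=> s se; apply: xU; split => // k j; rewrite ord1 mxE.
case: ifP => [/xA0 ->|_].
  rewrite /ball/= sub0r normrN (le_lt_trans (se j))// ltr_pdivrMr//.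
  by rewrite ltr_pMr// ltr1n.
have : ball x e y by near: y; exact: nbhsx_ballx.
by move=> [_]; apply.
Unshelve. all: by end_near. Qed.

Lemma ord_pred_ord0 (n : nat) : ord_pred (ord0 : 'I_n.+1) = ord_max.
Proof. by apply: val_inj; rewrite /= modn_small. Qed.

Lemma ordS_ord0 (n : nat) : ordS (ord0 : 'I_n.+2) = lift ord0 ord0.
Proof. exact: val_inj. Qed.

(* If [x_0 = 0] then [x_0] can be perturbed without a sign change at index 0. *)
Lemma Nm_lt_dim (R : realType) (n : nat) (x : 'rV[R]_n.+2) :
  x 0 ord0 = 0 -> (Nm x < n.+2)%N.
Proof.
move=> x0.
have xA i : pred1 ord0 i -> x 0 i = 0 by move=> /eqP->.
have [y [[e e0 yU] Ly _]] := Nm_attained (near_set_coord (near_signN x) xA).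
(* [s] is small and has the sign that makes the product at index 0 positive. *)
pose s := Num.sg (delta R (ord0 : 'I_n.+2) * y 0 (ord_pred ord0)) * e.
have dy0 : delta R (ord0 : 'I_n.+2) * y 0 (ord_pred ord0) != 0.
  by rewrite mulf_neq0 ?delta_neq0 ?Ly.
have s0 : s != 0 by rewrite /s mulf_neq0 ?sgr_eq0 ?(gt_eqF e0).
have se : `|s| <= e by rewrite /s normrM normr_sg dy0 mul1r gtr0_norm.
have := yU (fun=> s) (fun=> se); set z := \row_j _ => zU.
have Lz : Lambda z by move=> j; rewrite mxE; case: ifP => // _; exact: Ly.
have /andP[Nz _] := zU Lz.
rewrite (leq_ltn_trans Nz)// -[X in (_ < X)%N]card_ord; apply: proper_card.
apply/properP; split; first exact/subset_predT.
exists ord0 => //; rewrite !inE !mxE/= ord_pred_ord0/= -leNgt mulrAC /s ord_pred_ord0 mulrCA.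
by rewrite mulrA -normrEsg mulr_ge0// ltW.
Qed.

(* If [x_0 = x_1 = 0] then both can be given signs creating no sign change at the
   indices 0 and 1; flipping [x_0] then creates two. *)
Lemma Nm_lt_NM (R : realType) (n : nat) (x : 'rV[R]_n.+3) :
  x 0 ord0 = 0 -> x 0 (ordS ord0) = 0 -> (Nm x < NM x)%N.
Proof.
move=> x0 x1; pose A := pred2 ord0 (ordS (ord0 : 'I_n.+3)).
have xA i : A i -> x 0 i = 0 by move=> /pred2P[]->.
have [y [[e e0 yU] Ly _]] := Nm_attained (near_set_coord (near_signN x) xA).
pose s := Num.sg (delta R (ord0 : 'I_n.+3) * y 0 (ord_pred ord0)) * e.
have dy0 : delta R (ord0 : 'I_n.+3) * y 0 (ord_pred ord0) != 0.
  by rewrite mulf_neq0 ?delta_neq0 ?Ly.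
have s0 : s != 0 by rewrite /s mulf_neq0 ?sgr_eq0 ?(gt_eqF e0).
have se : `|s| <= e by rewrite /s normrM normr_sg dy0 mul1r gtr0_norm.
have := yU (fun=> s) (fun=> se); set z := \row_j _ => zU.
have := yU (fun i => if i == ord0 then - s else s); set w := \row_j _ => wU.
have Lz : Lambda z by move=> j; rewrite mxE; case: ifP => // _; exact: Ly.
have Lw : Lambda w.
  by move=> j; rewrite mxE; case: ifP => [_|_]; [case: ifP; rewrite ?oppr_eq0|exact: Ly].
have /andP[Nz _] := zU Lz.
have /(_ Lw)/andP[_ Nw] : Lambda w -> (Nm x <= signN w <= NM x)%N.
  by apply: wU => i; case: ifP; rewrite ?normrN.
apply: leq_ltn_trans Nz _; apply: leq_trans Nw.
have split01 (v : 'rV[R]_n.+3) (F := fun i => (delta R i * v 0 i * v 0 (ord_pred i) < 0)%R) :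
    signN v = (F ord0 + (F (lift ord0 ord0) +
      \sum_(i | (i != ord0) && (i != lift ord0 ord0)) (F i : nat)))%N.
  by rewrite signN_sum (bigD1 ord0)//= (bigD1 (lift ord0 ord0)).
have sgs : 0 < s * (delta R (ord0 : 'I_n.+3) * y 0 (ord_pred ord0)).
  by rewrite /s mulrAC -normrEsg pmulr_lgt0// normr_gt0.
rewrite !split01 {split01}.
(* For [i] other than 0 and 1, neither [i] nor its predecessor is 0, the only coordinate where [z]
   and [w] differ, so the remaining sums coincide. *)
rewrite (eq_bigr (fun i => (delta R i * w 0 i * w 0 (ord_pred i) < 0)%R : nat)); last first.
  move=> i /andP[i0 i1]; rewrite !mxE /A/= ordS_ord0 (negPf i0) (negPf i1)/=.
  rewrite (_ : (ord_pred i == ord0) = false)//.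
  by apply/negbTE; apply: contra i1 => /eqP pi0; rewrite -ordS_ord0 -pi0 ord_predK.
have predl : ord_pred (lift ord0 ord0 : 'I_n.+3) = ord0 by rewrite -ordS_ord0 ordSK.
rewrite !mxE /A/= !predl !ord_pred_ord0 ordS_ord0/=.
have q : 0 < delta R (ord0 : 'I_n.+3) * s * y 0 ord_max.
  by move: sgs; rewrite ord_pred_ord0 mulrCA mulrA.
have ss : 0 < s * s by rewrite -expr2 exprn_even_gt0.
have -> : delta R (lift ord0 ord0 : 'I_n.+3) = 1 by [].
move: q; move: (delta R ord0) => d q.
by rewrite mul1r !mulrN mulNr !oppr_lt0 (lt_gtF ss) (lt_gtF q) ss q /=; lia.
Qed.

(** * Sign changes along solutions *)

Section ScalarODE.
Variable R : realType.
Implicit Types (u w f al : R -> R).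

Lemma is_derive_continuous w (t d : R) : is_derive t 1 w d -> {for t, continuous w}.
Proof.
by move=> wd; apply: differentiable_continuous; apply/derivable1_diffP; exact: ex_derive.
Qed.

Lemma is_derive_gt0_left w (t d : R) : is_derive t 1 w d -> 0 < d ->
  \forall s \near t^'-, w s < w t.
Proof.
move=> wd d0.
have : h^-1 *: ((w \o shift t) (h *: 1) - w t) @[h --> 0^'] --> d.
  by have <- := @derive_val _ _ _ _ _ _ _ wd; have [] := wd.
move=> /cvgr_gt/(_ _ d0)/nbhs_ballP[e /= e0 He].
near=> s; have st : s < t by near: s; exact: nbhs_left_lt.
have ts : t - e < s by near: s; apply: nbhs_left_gt; rewrite ltrBlDr ltrDl.
have := He (s - t); rewrite /ball/= sub0r opprB gtr0_norm ?subr_gt0//.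
rewrite subr_eq0 lt_eqF// ltrBlDr -ltrBlDl => /(_ ts isT).
rewrite /GRing.scale/= mulr1 subrK.
by rewrite nmulr_rgt0 ?invr_lt0 ?subr_lt0.
Unshelve. all: by end_near. Qed.

(* At a nonpositive minimum after [tau] of [expR (- K s) * u s] the derivative would be
   positive. *)
Lemma linear_ode_gt0 u f al (tau e K : R) : u tau = 0 ->
  {for tau, continuous u} ->
  (forall s, tau < s < tau + e -> is_derive s 1 u (f s + al s * u s)) ->
  (forall s, tau < s < tau + e -> al s <= K) ->
  (forall s, tau < s < tau + e -> 0 < f s) ->
  forall s, tau < s < tau + e -> 0 < u s.
Proof.
move=> u0 uc ud alK f0 s /andP[taus se]; rewrite ltNge; apply/negP => us.
pose w r := expR (- (K * r)) * u r.
have wd r : tau < r < tau + e ->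
    is_derive r 1 w (expR (- (K * r)) * (f r + (al r - K) * u r)).
  move=> re; have udr := ud _ re.
  rewrite /w; apply: is_derive_eq.
  rewrite /GRing.scale/=; ring.
have wc : {within `[tau, s], continuous w}.
  apply: continuous_in_subspaceT => r /set_mem/=; rewrite in_itv/= => /andP[].
  rewrite le_eqVlt => /predU1P[<- _|taur rs]; last first.
    by apply: (is_derive_continuous (wd r _)); rewrite taur (le_lt_trans rs).
  have ed : is_derive tau 1 (fun r => expR (- (K * r))) (expR (- (K * tau)) * - K).
    by apply: is_derive_eq; rewrite /GRing.scale/=; ring.
  exact: continuousM (is_derive_continuous ed) uc.
have [c] := EVT_min (ltW taus) wc; rewrite in_itv/= => /andP[tc cs] wmin.
(* If the minimum found is at [tau], where [w] vanishes, then [w s <= 0] makes [s] a minimum too; so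
   there is one strictly after [tau]. *)
have [m /andP[taum ms] [wm wm0]] : exists2 m, tau < m <= s &
    (forall r, tau <= r <= s -> w m <= w r) /\ w m <= 0.
  have w0 : w tau = 0 by rewrite /w u0 mulr0.
  have ws0 : w s <= 0 by rewrite /w pmulr_rle0 ?expR_gt0.
  move: tc; rewrite le_eqVlt => /predU1P[tc|tc]; last first.
    exists c; first by rewrite tc.
    split; last by rewrite (le_trans (wmin _ _) ws0)// in_itv/= lexx ltW.
    by move=> r rts; apply: wmin; rewrite in_itv.
  exists s; first by rewrite taus lexx.
  split=> // r rts; rewrite (le_trans ws0)// -w0 tc; apply: wmin.
  by rewrite in_itv.
have me : tau < m < tau + e by rewrite taum (le_lt_trans ms).
have um0 : u m <= 0 by move: wm0; rewrite /w pmulr_rle0 ?expR_gt0.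
have dw0 : 0 < expR (- (K * m)) * (f m + (al m - K) * u m).
  rewrite mulr_gt0 ?expR_gt0//; have := f0 _ me; have := alK _ me; nra.
have := is_derive_gt0_left (wd _ me) dw0 => lt_w.
have : \forall s \near m^'-, False.
  near=> r; have : w m <= w r.
    apply: wm; apply/andP; split; first by near: r; exact: nbhs_left_ge.
    by rewrite (le_trans _ ms)//; near: r; exact: nbhs_left_le.
  by rewrite leNgt; apply/negP; rewrite negbK; near: r.
by move=> /filter_ex[].
Unshelve. all: by end_near. Qed.
End ScalarODE.

(** Descending from [j] reaches 0, whose predecessor is the last index, and descending from there
    reaches every index. *)
Lemma ord_pred_ind (n : nat) (Q : 'I_n.+1 -> Prop) (j : 'I_n.+1) :
  Q j -> (forall i, Q i -> Q (ord_pred i)) -> forall i, Q i.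
Proof.
move=> Qj QS.
have descend k (i i' : 'I_n.+1) : Q i' -> (i' = i + k :> nat)%N -> Q i.
  elim: k i i' => [|k IH] i i' Qi' ik.
    by rewrite (_ : i = i')//; apply: val_inj; rewrite /= ik addn0.
  apply: (IH i (ord_pred i')); first exact: QS.
  have i'n := ltn_ord i'.
  rewrite /= (_ : (i' + n.+1).-1 = i + k + n.+1)%N; last by lia.
  by rewrite modnDr modn_small//; lia.
have Q0 : Q ord0 by apply: (descend j _ _ Qj).
have Qm : Q ord_max by rewrite -ord_pred_ord0; exact: QS.
move=> i; apply: (descend (n - i)%N _ _ Qm).
by rewrite /= subnKC// -ltnS.
Qed.

Lemma at_right_exists (R : realType) (tau : R) (P : set R) :
  (\forall s \near tau^'+, P s) ->
  exists2 e : R, 0 < e & forall s, tau < s < tau + e -> P s.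
Proof.
move=> /nbhs_ballP[e /= e0 He]; exists e => // s /andP[ts se].
by apply: He => //; rewrite /ball/= distrC gtr0_norm ?subr_gt0// ltrBlDl.
Qed.

Section CyclicSystem.
Variables (R : realType) (n : nat) (x : R -> 'rV[R]_n.+1).
Variables (al be : 'I_n.+1 -> R -> R) (kappa : 'I_n.+1 -> R).
Hypothesis xd : forall (s : R) i, is_derive s 1 (fun s => x s 0 i)
  (be i s * x s 0 (ord_pred i) + al i s * x s 0 i).
Hypothesis alc : forall i, continuous (al i).
Hypothesis kappa_be : forall i s, 0 < kappa i * be i s.

Let xc i (s : R) : {for s, continuous (fun s => x s 0 i)}.
Proof. exact: is_derive_continuous (xd s i). Qed.

(** The function [kappa i * sg * x_i] vanishes at [tau] and solves a scalar linear equation with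
    positive forcing. The signs [kappa] stay general because time reversal replaces [delta] by
    [- delta]. *)
Lemma sign_after tau i : x tau 0 i = 0 ->
  forall sg : R, (\forall s \near tau^'+, 0 < sg * x s 0 (ord_pred i)) ->
  \forall s \near tau^'+, 0 < kappa i * sg * x s 0 i.
Proof.
move=> xi0 sg sg_pred.
have /at_right_exists[e e0 He] : \forall s \near tau^'+,
    0 < sg * x s 0 (ord_pred i) /\ al i s <= al i tau + 1.
  near=> s; split; near: s => //.
  apply: (@cvgr_le _ _ (tau^'+) _ (al i) (al i tau)); last by rewrite ltrDl.
  apply: cvg_at_right_filter; exact: alc.
near=> s; apply: (@linear_ode_gt0 R (fun s => kappa i * sg * x s 0 i)
  (fun s => kappa i * be i s * (sg * x s 0 (ord_pred i))) (al i) tau e (al i tau + 1)).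
- by rewrite xi0 mulr0.
- by apply: continuousM; [exact: cst_continuous|exact: xc].
- move=> r re; have := xd r i => xdr; apply: is_derive_eq.
  rewrite /GRing.scale/=; ring.
- by move=> r /He[].
- by move=> r /He[p _]; rewrite mulr_gt0.
- apply/andP; split; near: s; first exact: nbhs_right_gt.
  by apply: nbhs_right_lt; rewrite ltrDl.
Unshelve. all: by end_near. Qed.

Lemma right_nbhs_signs tau : x tau != 0 ->
  \forall s \near tau^'+, forall i, [/\ x s 0 i != 0,
    x tau 0 i != 0 -> 0 < x s 0 i * x tau 0 i &
    x tau 0 i = 0 -> 0 < kappa i * (x s 0 i * x s 0 (ord_pred i))].
Proof.
move=> xtau.
have agree i : x tau 0 i != 0 -> \forall s \near tau^'+, 0 < x tau 0 i * x s 0 i.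
  move=> xi; have : x tau 0 i * x s 0 i @[s --> tau^'+] --> x tau 0 i * x tau 0 i.
    by apply: cvgMr; apply: cvg_at_right_filter; exact: xc.
  by move=> /cvgr_gt; apply; rewrite -expr2 exprn_even_gt0.
(* Signs propagate from each coordinate to its successor, so one coordinate without constant sign
   after [tau] would force all its predecessors, hence all coordinates, to lack one and to vanish at
   [tau]. *)
have const_sign i : exists sg, \forall s \near tau^'+, 0 < sg * x s 0 i.
  apply: contrapT => ni.
  have : x tau = 0.
    apply/rowP => j; rewrite mxE.
    suff : ~ (exists sg, \forall s \near tau^'+, 0 < sg * x s 0 j).
      by move=> nj; apply/eqP; apply: contrapT => /negP/agree xj; apply: nj; exists (x tau 0 j).
    move: j; apply: (@ord_pred_ind n _ i ni) => j nj [sg sgj]; apply: nj.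
    have [xj|/agree xj] := eqVneq (x tau 0 j) 0; last by exists (x tau 0 j).
    by exists (kappa j * sg); exact: sign_after.
  by move/eqP; rewrite (negPf xtau).
apply: filter_forall => i; have [xi|xi] := eqVneq (x tau 0 i) 0.
  have [sg sgp] := const_sign (ord_pred i); have sgi := sign_after xi sgp.
  near=> s.
  have p1 : 0 < sg * x s 0 (ord_pred i) by near: s.
  have p2 : 0 < kappa i * sg * x s 0 i by near: s.
  split=> // [|_].
    by apply: contraTneq p2 => ->; rewrite mulr0 ltxx.
  have : 0 < (kappa i * (x s 0 i * x s 0 (ord_pred i))) * sg ^+ 2.
    by have := mulr_gt0 p1 p2; congr (0 < _); ring.
  by rewrite pmulr_lgt0// exprn_even_gt0//=; apply: contraTneq p1 => ->; rewrite mul0r ltxx.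
near=> s; have p : 0 < x tau 0 i * x s 0 i by near: s; exact: agree.
split=> //; last by move/eqP; rewrite (negPf xi).
  by apply: contraTneq p => ->; rewrite mulr0 ltxx.
by rewrite mulrC.
Unshelve. all: by end_near. Qed.

Lemma continuous_bounded_itv (f : R -> R) (t : R) : 0 <= t -> continuous f ->
  exists B, forall s, 0 <= s <= t -> `|f s| <= B.
Proof.
move=> t0 fc; have [|c _ cmax] := @EVT_max R (fun s => `|f s|) 0 t t0.
  by apply: continuous_subspaceT => s; apply: continuous_comp; [exact: fc|exact: norm_continuous].
by exists `|f c| => s st; apply: cmax; rewrite in_itv.
Qed.

Hypothesis bec : forall i, continuous (be i).

(* [expR (4 B s) * |x s|^2] is nondecreasing when [B] bounds the coefficients. *)
Lemma solution_neq0 (t : R) : x 0 != 0 -> 0 <= t -> x t != 0.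
Proof.
move=> x0 t0.
have [B HB] : exists B, forall i s, 0 <= s <= t -> `|al i s| <= B /\ `|be i s| <= B.
  have /choice[A HA] : forall i, exists B, forall s, 0 <= s <= t -> `|al i s| + `|be i s| <= B.
    move=> i; have [A HA] := continuous_bounded_itv t0 (@alc i).
    have [B HB] := continuous_bounded_itv t0 (@bec i).
    by exists (A + B) => s st; rewrite lerD ?HA ?HB.
  exists (\sum_i A i) => i s st; have := HA i s st.
  have : A i <= \sum_i A i.
    rewrite (bigD1 i)//= lerDl sumr_ge0// => j _; apply: le_trans (HA j s st).
    by rewrite addr_ge0.
  have := normr_ge0 (al i s); have := normr_ge0 (be i s); lra.
pose V s := \sum_i x s 0 i ^+ 2.
pose dx s i := be i s * x s 0 (ord_pred i) + al i s * x s 0 i.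
pose E s := expR (4 * B * s) * V s.
have Ed (s : R) : is_derive s 1 E (expR (4 * B * s) *
    \sum_i (4 * B * x s 0 i ^+ 2 + 2 * x s 0 i * dx s i)).
  have Vd : is_derive s 1 V (\sum_i (2 * x s 0 i * dx s i)).
    rewrite (_ : V = \sum_i (fun s => x s 0 i ^+ 2)); last first.
      by apply/funext => r; rewrite fct_sumE.
    apply: is_derive_sum => i; have xdi := xd s i; apply: is_derive_eq.
    by rewrite /GRing.scale/= /dx; ring.
  rewrite /E; apply: is_derive_eq.
  rewrite big_split/= -mulr_sumr -/(V s) /GRing.scale/=; ring.
have : E 0 <= E t.
  apply: (@ger0_derive1_ndecr R E 0 t) => //.
  - move=> s; rewrite in_itv/= => /andP[/ltW s0 /ltW st].
    have [_ dE] := Ed s; rewrite derive1E dE mulr_ge0 ?expR_ge0//.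
    (* Subtracting this cyclic sum, which is zero, turns each term of the derivative into
       [(p1 + p2) / 2 + 2 p3]. *)
    have sum0 : \sum_i B * (x s 0 i ^+ 2 - x s 0 (ord_pred i) ^+ 2) = 0.
      rewrite -mulr_sumr sumrB (reindex_inj (@ord_pred_inj n.+1))/= subrr mulr0//.
    rewrite -[leLHS]sum0; apply: ler_sum => i _; rewrite /dx.
    have [|] := HB i s; first by rewrite s0.
    rewrite !ler_norml => /andP[a1 a2] /andP[b1 b2].
    set u := x s 0 i; set v := x s 0 (ord_pred i).
    have p1 : 0 <= (B + be i s) * (u + v) ^+ 2 by rewrite mulr_ge0 ?sqr_ge0//; lra.
    have p2 : 0 <= (B - be i s) * (u - v) ^+ 2 by rewrite mulr_ge0 ?sqr_ge0//; lra.
    have p3 : 0 <= (B + al i s) * u ^+ 2 by rewrite mulr_ge0 ?sqr_ge0//; lra.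
    lra.
  - by apply: continuous_subspaceT => s; exact: is_derive_continuous (Ed s).
apply: contraTneq => xt; rewrite -ltNge /E /V mulr0 expR0 mul1r.
rewrite big1 ?mulr0; last by move=> i _; rewrite xt mxE expr0n.
rewrite lt_neqAle sumr_ge0 ?andbT; last by move=> i _; exact: sqr_ge0.
rewrite eq_sym; apply: contra x0; rewrite psumr_eq0; last by move=> i _; exact: sqr_ge0.
move=> /allP h; apply/eqP/rowP => i; apply/eqP.
by rewrite mxE -sqrf_eq0 (eqP (h i _)) ?mem_index_enum.
Qed.

End CyclicSystem.

Section NegativeFeedback.
Variables (R : realType) (n : nat) (x : R -> 'rV[R]_n.+1).
Variables (al be : 'I_n.+1 -> R -> R).
Hypothesis xd : forall (s : R) i, is_derive s 1 (fun s => x s 0 i)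
  (be i s * x s 0 (ord_pred i) + al i s * x s 0 i).
Hypothesis alc : forall i, continuous (al i).
Hypothesis bec : forall i, continuous (be i).
Hypothesis delta_be : forall i s, 0 < delta R i * be i s.

Lemma near_right_Nm tau : x tau != 0 ->
  \forall s \near tau^'+, Lambda (x s) /\ (signN (x s) <= Nm (x tau))%N.
Proof.
move=> xtau.
have := right_nbhs_signs xd alc delta_be xtau; apply: filterS => s H.
have Ls : Lambda (x s) by move=> i; have [] := H i.
by split=> //; apply: signN_le_Nm => // i; have [] := H i.
Qed.

(* Reversing time turns the feedback signs [delta] into [- delta]. *)
Lemma near_left_NM tau : x tau != 0 ->
  \forall s \near tau^'-, Lambda (x s) /\ (NM (x tau) <= signN (x s))%N.
Proof.
move=> xtau.
pose y s := x (- s); pose al' i s := - al i (- s); pose be' i s := - be i (- s).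
have yd (s : R) i : is_derive s 1 (fun s => y s 0 i)
    (be' i s * y s 0 (ord_pred i) + al' i s * y s 0 i).
  have xdi := xd (- s) i.
  have Nd : is_derive s 1 (fun s : R => - s) (-1) by apply: is_derive_eq.
  apply: (is_derive_eq (@is_derive1_comp R (fun r => x r 0 i) -%R s _ _ xdi Nd)).
  rewrite /be' /al' /y; ring.
have al'c i : continuous (al' i).
  move=> s; apply: continuousN; apply: continuous_comp; last exact: alc.
  exact: opp_continuous.
have be'_lt0 i s : 0 < - delta R i * be' i s by rewrite mulrNN.
have ytau : y (- tau) != 0 by rewrite /y opprK.
have [e e0 He0] := at_right_exists (right_nbhs_signs yd al'c be'_lt0 ytau).
near=> s; have {}He : - tau < - s < - tau + e.
  rewrite ltrN2; apply/andP; split; first by near: s; exact: nbhs_left_lt.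
  rewrite ltrNl opprD opprK; near: s; apply: nbhs_left_gt.
  by rewrite ltrBlDr ltrDl.
have {He}H := He0 _ He.
rewrite /y !opprK in H.
have Ls : Lambda (x s) by move=> i; have [] := H i.
split=> //; apply: NM_le_signN => // i; have [_ H1 H2] := H i => //.
by move=> /H2; rewrite mulNr oppr_gt0.
Unshelve. all: by end_near. Qed.

(** Let [sig] be the infimum of the times violating the bound. It is not such a time, since times
    just before it would violate the bound too. Hence [Nm (x sig) <= Nm (x 0)], and then no
    violation occurs just after [sig], which contradicts the choice of [sig]. *)
Lemma NM_le_Nm_flow (t : R) : x 0 != 0 -> 0 < t -> (NM (x t) <= Nm (x 0))%N.
Proof.
move=> x0 t0; rewrite leqNgt; apply/negP => bad.
have xn0 s : 0 <= s -> x s != 0.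
  exact: (solution_neq0 xd alc bec).
pose B := [set s | 0 < s /\ (Nm (x 0) < NM (x s))%N].
have B0 : has_inf B by split; [exists t|exists 0 => s [/ltW]].
pose sig := inf B.
have sig0 : 0 <= sig by apply: lb_le_inf => [|s [/ltW]//]; exists t.
have [Bsig|nBsig] := pselect (B sig).
  have /near_left_NM H : x sig != 0 by exact: xn0.
  have : \forall s \near sig^'-, False.
    near=> s; have [Ls NMs] : Lambda (x s) /\ (NM (x sig) <= signN (x s))%N by near: s.
    have : sig <= s.
      apply: ge_inf; first by case: B0.
      split; last by rewrite NM_Lambda//; exact: leq_trans Bsig.2 NMs.
      by near: s; apply: nbhs_left_gt; case: Bsig.
    by apply/negP; rewrite -ltNge; near: s; exact: nbhs_left_lt.
  by move=> /filter_ex[].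
have Nsig : (Nm (x sig) <= Nm (x 0))%N.
  move: sig0; rewrite le_eqVlt => /predU1P[<-//|sig0].
  rewrite (leq_trans (Nm_le_NM _))// leqNgt; apply/negP => h.
  by apply: nBsig; split.
have /near_right_Nm/nbhs_ballP[e /= e0 He] : x sig != 0 by exact: xn0.
have [s [s0 Ns] se] := inf_adherent e0 B0.
have sigs : sig < s.
  rewrite lt_neqAle ge_inf ?andbT; [|by case: B0|by split].
  by apply: contra_notN nBsig => /eqP ->; split.
have [|Ls] := He s _ sigs.
  by rewrite /ball/= distrC gtr0_norm ?subr_gt0// ltrBlDl.
rewrite -(NM_Lambda Ls) => /leq_trans/(_ Nsig).
by rewrite leqNgt Ns.
Unshelve. all: by end_near. Qed.

End NegativeFeedback.

(** * Pseudo-orbits *)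

Lemma coord_le_norm (R : realType) (n : nat) (x : 'rV[R]_n) j : `|x 0 j| <= `|x|.
Proof.
rewrite [leRHS]/Num.norm/= mx_normrE.
exact: (le_bigmax _ (fun ij : 'I_1 * 'I_n => `|x ij.1 ij.2|) (0, j)).
Qed.

Lemma norm_le_coord (R : realType) (n : nat) (x : 'rV[R]_n) (B : R) : 0 <= B ->
  (forall j, `|x 0 j| <= B) -> `|x| <= B.
Proof.
move=> B0 xB; rewrite [leLHS]/Num.norm/= mx_normrE; apply/bigmax_leP; split=> // -[i j] _ /=.
by rewrite ord1.
Qed.

Lemma mulmx_norm_le (R : realType) (m n : nat) (N : 'M[R]_(m, n)) :
  exists2 C : R, 0 <= C & forall x : 'rV[R]_m, `|x *m N| <= C * `|x|.
Proof.
exists (\sum_i \sum_j `|N i j|); first by apply: sumr_ge0 => i _; exact: sumr_ge0.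
move=> x; apply: norm_le_coord => [|j].
  by rewrite mulr_ge0// sumr_ge0// => i _; exact: sumr_ge0.
rewrite mxE (le_trans (ler_norm_sum _ _ _))// mulr_suml; apply: ler_sum => i _.
rewrite normrM mulrC ler_pM ?coord_le_norm//.
by rewrite (bigD1 j)//= lerDl sumr_ge0.
Qed.

Lemma mulmx_continuous (R : realType) (m n : nat) (N : 'M[R]_(m, n)) :
  continuous (fun x : 'rV[R]_m => x *m N).
Proof.
have [C _ HC] := mulmx_norm_le N.
move=> x0; apply: (@bounded_linear_continuous R 'rV[R]_m 'rV[R]_n (mulmxr N)).
apply/linear_boundedP; near=> r => x; rewrite /= (le_trans (HC x))// ler_wpM2r//.
Unshelve. all: by end_near. Qed.

Lemma mulmx_exprSr (R : nzRingType) (n : nat) (x : 'rV[R]_n.+1) (M : 'M[R]_n.+1) k :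
  x *m M ^+ k.+1 = x *m M ^+ k *m M.
Proof. by rewrite exprSr -mulmxA. Qed.

Lemma mulmx_exprS (R : nzRingType) (n : nat) (x : 'rV[R]_n.+1) (M : 'M[R]_n.+1) k :
  x *m M ^+ k.+1 = x *m M *m M ^+ k.
Proof. by rewrite exprS -mulmxA. Qed.

Lemma unitmx_expr (R : comUnitRingType) (n : nat) (M : 'M[R]_n.+1) k :
  M \in unitmx -> M ^+ k \in unitmx.
Proof. exact: (@unitrX _ M k). Qed.

Lemma mulmx_unit_neq0 (R : comUnitRingType) (n : nat) (x : 'rV[R]_n) (M : 'M[R]_n) :
  M \in unitmx -> x != 0 -> x *m M != 0.
Proof.
by move=> Mu; apply: contra => /eqP xM; rewrite -(mulmxK Mu x) xM mul0mx.
Qed.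

Section Chain.
Variables (R : realType) (n : nat) (M : 'M[R]_n.+1).
Hypothesis Mu : M \in unitmx.
Hypothesis NMM : forall x : 'rV[R]_n.+1, x != 0 -> (NM (x *m M) <= Nm x)%N.
Implicit Types (x y p q w : 'rV[R]_n.+1).

(* The quantity [|w - (p + q) M|] is positive on the compact set of triples with
   [Num.max |p| |q| = 1] and [|w|] bounded that violate the conclusion. *)
Lemma Nm_le_NM_pseudo_orbit (c c' : nat) : (c < c')%N ->
  exists2 e : R, 0 < e & forall p q w, (Nm (p *m invmx M) <= c)%N -> (c' <= NM q)%N ->
    p != 0 -> `|w - (p + q) *m M| <= e * Num.max `|p| `|q| -> (NM w <= Nm (p + q))%N.
Proof.
move=> cc'.
have [C C0 HC] := mulmx_norm_le M.
(* [2 * C] bounds [(p + q) M] for [p] and [q] in the unit ball, and 1 will bound the defect. *)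
pose B := 2 * C + 1.
pose T := ('rV[R]_n.+1 * 'rV[R]_n.+1 * 'rV[R]_n.+1)%type.
pose ball_ r := [set v : 'rV[R]_n.+1 | `|v| <= r].
have ball_compact r : compact (ball_ r).
  apply: bounded_closed_compact.
    by exists r; split; [exact: num_real|move=> b rb v /le_trans; apply; exact: ltW].
  exact: (preimage_closed (fun v _ => @norm_continuous _ _ v) (@closed_le R r)).
pose K := [set z : T | `|z.1.1| <= 1] `&` ([set z : T | `|z.1.2| <= 1] `&`
  ([set z : T | `|z.2| <= B] `&` ([set z : T | 1 <= Num.max `|z.1.1| `|z.1.2|] `&`
  ([set z : T | (Nm (z.1.1 *m invmx M) <= c)%N] `&` ([set z : T | (c' <= NM z.1.2)%N] `&`
  [set z : T | (Nm (z.1.1 + z.1.2) < NM z.2)%N]))))).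
pose f (z : T) : R := `|z.2 - (z.1.1 + z.1.2) *m M|.
(* At zero defect, [w = (p + q) M] contradicts [NMM] unless [q = - p]; in that case
   [NM q = NM p <= Nm (p M^-1) <= c < c']. *)
have fpos z : K z -> 0 < f z.
  move=> [_ [_ [_ [/= m1 [/= Np [/= Nq /= Nw]]]]]]; rewrite normr_gt0 subr_eq0; apply/eqP => wE.
  have [pq0|pq0] := eqVneq (z.1.1 + z.1.2) 0; last first.
    by have := NMM pq0; rewrite -wE leqNgt Nw.
  have qp : z.1.2 = - z.1.1 by apply/eqP; rewrite -addr_eq0 addrC pq0.
  have p0 : z.1.1 != 0.
    apply: contraTneq m1 => p0; rewrite qp p0 oppr0 normr0 maxxx.
    by rewrite -ltNge ltr01.
  have Mp0 : z.1.1 *m invmx M != 0.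
    by rewrite mulmx_unit_neq0// unitmx_inv.
  have := NMM Mp0; rewrite mulmxKV// => h.
  move: Nq; rewrite qp -scaleN1r NMZ ?oppr_eq0 ?oner_eq0//.
  by rewrite leqNgt (leq_ltn_trans (leq_trans h Np) cc').
have p_cont : continuous (fun z : T => z.1.1).
  by move=> z; apply: continuous_comp; exact: cvg_fst.
have q_cont : continuous (fun z : T => z.1.2).
  by move=> z; apply: continuous_comp; [exact: cvg_fst|exact: cvg_snd].
have w_cont : continuous (fun z : T => z.2) by move=> z; exact: cvg_snd.
have pq_cont : continuous (fun z : T => z.1.1 + z.1.2).
  by move=> z; exact: (continuousD (p_cont z) (q_cont z)).
have Kc : compact K.
  apply: (@subclosed_compact _ _ (ball_ 1 `*` ball_ 1 `*` ball_ B)); last 2 first.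
  - by do 2 apply: compact_setX => //.
  - by move=> z [p1 [q1 [wB _]]].
  have norm_cont (g : T -> 'rV[R]_n.+1) : continuous g -> continuous (fun z => `|g z|).
    by move=> gc z; apply: continuous_comp; [exact: gc|exact: norm_continuous].
  have norm_closed (g : T -> 'rV[R]_n.+1) r : continuous g -> closed [set z | `|g z| <= r].
    move=> gc; apply: (@preimage_closed _ _ (fun z => `|g z|) [set a : R | a <= r]);
      last exact: closed_le.
    by move=> z _; exact: norm_cont.
  do 3 (apply: closedI; first exact: norm_closed).
  do 3 ? apply: closedI.
  - apply: (@preimage_closed _ _ (fun z : T => Num.max `|z.1.1| `|z.1.2|) [set a : R | 1 <= a]);
      last exact: closed_ge.
    by move=> z _; exact: (continuous_max (norm_cont _ p_cont z) (norm_cont _ q_cont z)).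
  - apply: (@preimage_closed _ _ (fun z : T => z.1.1 *m invmx M) [set v | (Nm v <= c)%N]);
      last exact: closed_Nm_le.
    by move=> z _; exact: (continuous_comp (p_cont z) (@mulmx_continuous R _ _ (invmx M) _)).
  - apply: (@preimage_closed _ _ (fun z : T => z.1.2) [set v | (c' <= NM v)%N]);
      last exact: closed_NM_ge.
    by move=> z _; exact: q_cont.
  (* By semicontinuity the reverse inequality [NM w <= Nm (p + q)] is an open condition. *)
  - rewrite -(setCK [set z | _]); apply: open_closedC.
    rewrite openE => z /= /negP; rewrite -leqNgt => wpq.
    have H1 : \forall y \near z, (Nm (z.1.1 + z.1.2)%R <= Nm ((y : T).1.1 + y.1.2)%R)%N.
      have : nbhs z [set y : T | _] := pq_cont z _ (near_Nm_NM (z.1.1 + z.1.2)).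
      by apply: filterS => y [].
    have H2 : \forall y \near z, (NM (y : T).2 <= NM z.2)%N.
      have : nbhs z [set y : T | _] := w_cont z _ (near_Nm_NM z.2).
      by apply: filterS => y [].
    apply: filterS2 H1 H2 => y le1 le2; apply/negP; rewrite -leqNgt.
    exact: leq_trans le2 (leq_trans wpq le1).
have fc : continuous f.
  move=> z; have pqM := continuous_comp (pq_cont z) (@mulmx_continuous R _ _ M _).
  exact: (continuous_comp (continuousB (w_cont z) pqM) (@norm_continuous _ _ _)).
have [e e0 He] : exists2 e : R, 0 < e & forall z, K z -> e <= f z.
  have [[z0 Kz0]|nK] := pselect (K !=set0); last first.
    by exists 1 => // z Kz; case: nK; exists z.
  have Kn0 : K !=set0 by exists z0.
  have [z /set_mem Kz zmin] := compact_EVT_min Kn0 Kc (continuous_subspaceT fc).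
  by exists (f z); [exact: fpos|move=> z' Kz'; apply: zmin; exact/mem_set].
(* Halving makes the comparison with the lower bound [e] strict; the cap 1 keeps the normalized [w]
   within [B]. *)
exists (Num.min 1 (e / 2)) => [|p q w Np Nq p0 wpq].
  by rewrite lt_min ltr01 divr_gt0.
set m := Num.max `|p| `|q| in wpq.
have m0 : 0 < m by rewrite lt_max normr_gt0 p0.
have mV : m^-1 != 0 by rewrite invr_neq0 ?gt_eqF.
rewrite leqNgt; apply/negP => Nw.
pose z : T := (m^-1 *: p, m^-1 *: q, m^-1 *: w).
have normmV v : `|m^-1 *: v| = `|v| / m.
  by rewrite normrZ gtr0_norm ?invr_gt0// mulrC.
have fz : f z <= Num.min 1 (e / 2).
  rewrite /f/= -scalerDr -scalemxAl -scalerBr normmV ler_pdivrMr//.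
have pm : `|m^-1 *: p| <= 1 by rewrite normmV ler_pdivrMr// mul1r le_max lexx.
have qm : `|m^-1 *: q| <= 1 by rewrite normmV ler_pdivrMr// mul1r le_max lexx orbT.
suff Kz : K z.
  have := He z Kz; apply/negP; rewrite -ltNge (le_lt_trans fz)// gt_min.
  by rewrite ltr_pdivrMr// ltr_pMr// ltr1n orbT.
split; first exact: pm.
split; first exact: qm.
split; [rewrite /=|split; [rewrite /=|]].
- have -> : m^-1 *: w = (m^-1 *: w - (m^-1 *: p + m^-1 *: q) *m M) +
      (m^-1 *: p + m^-1 *: q) *m M by rewrite subrK.
  rewrite (le_trans (ler_normD _ _))// /B addrC lerD//.
    rewrite (le_trans (HC _))// mulrC ler_wpM2r//.
    by rewrite (le_trans (ler_normD _ _))// (natrD R 1 1) lerD.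
  by rewrite (le_trans fz)// ge_min lexx.
- have mV0 : 0 <= m^-1 by rewrite invr_ge0 ltW.
  by rewrite !normmV -maxr_pMl// -/m divff// gt_eqF.
- by rewrite /= -scalemxAl -scalerDr !(NmZ, NMZ).
Qed.

Lemma Nm_forward x k : x != 0 -> (Nm (x *m M ^+ k) <= Nm x)%N.
Proof.
move=> x0; elim: k => [|k IH]; first by rewrite expr0 mulmx1.
rewrite mulmx_exprSr; apply: leq_trans (Nm_le_NM _) _.
by apply: leq_trans (NMM _) IH; rewrite mulmx_unit_neq0// unitmx_expr.
Qed.

Lemma NM_backward y k : y != 0 -> (NM y <= NM (y *m invmx M ^+ k))%N.
Proof.
move=> y0; elim: k => [|k IH]; first by rewrite expr0 mulmx1.
apply: leq_trans IH _; apply: leq_trans _ (Nm_le_NM _).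
have yV0 : y *m invmx M ^+ k.+1 != 0.
  by rewrite mulmx_unit_neq0// unitmx_expr// unitmx_inv.
by have := NMM yV0; rewrite {1}mulmx_exprSr mulmxKV.
Qed.

(** Damping by [theta ^- k] beats growth of rate [rho < theta]. Applied to [M] and to [invmx M],
    this controls the two ends of the pseudo-orbit. *)
Lemma geometric_decay x (N : 'M[R]_n.+1) (C rho theta : R) v : 0 < rho < theta ->
  (forall k, `|x *m N ^+ k| <= C * rho ^+ k) ->
  v + theta ^- k *: (x *m N ^+ k.+1) @[k --> \oo] --> v.
Proof.
move=> /andP[rho0 rt] Hx; have t0 : 0 < theta by exact: lt_trans rt.
have : (C * rho) * (rho / theta) ^+ k @[k --> \oo] --> (C * rho) * 0.
  apply: cvgMr; apply: cvg_expr.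
  by rewrite ger0_norm ?divr_ge0 1?ltW// ltr_pdivrMr// mul1r.
rewrite mulr0 => /cvgr0_norm_le lim0.
apply/cvgrPdist_le => e e0; near=> k.
rewrite opprD addNKr normrN normrZ ger0_norm; last by rewrite invr_ge0 exprn_ge0// ltW.
have : `|C * rho * (rho / theta) ^+ k| <= e by near: k; exact: lim0.
apply: le_trans; apply: le_trans (ler_norm _).
have -> : C * rho * (rho / theta) ^+ k = theta ^- k * (C * rho ^+ k.+1).
  by rewrite expr_div_n exprS; ring.
by rewrite ler_wpM2l// invr_ge0 exprn_ge0// ltW.
Unshelve. all: by end_near. Qed.

(** For [theta = 1 + h] the two factors move the image by at most [2 h C] times the larger norm,
    within the tolerance [e] of a pseudo-orbit. The choice of [h] divides by [C + 1] because [C] may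
    be 0. *)
Lemma Nm_le_NM_contraction (c c' : nat) : (c < c')%N ->
  exists2 theta : R, 1 < theta & forall p q, (Nm (p *m invmx M) <= c)%N -> (c' <= NM q)%N ->
    p != 0 -> (NM (theta^-1 *: (p *m M) + theta *: (q *m M)) <= Nm (p + q))%N.
Proof.
move=> /Nm_le_NM_pseudo_orbit[e e0 He].
have [C C0 HC] := mulmx_norm_le M.
have C1 : 0 < C + 1 by rewrite ltr_wpDl.
pose h := e / (2 * (C + 1)); pose theta := 1 + h.
have h0 : 0 < h by rewrite divr_gt0// mulr_gt0.
have t0 : 0 < theta by rewrite /theta; lra.
exists theta => [|p q Np Nq p0]; first by rewrite ltrDl.
apply: He => //.
rewrite mulmxDl opprD addrACA -scaleN1r -scalerDl -[- (q *m M)]scaleN1r -scalerDl.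
set mu := Num.max `|p| `|q|.
rewrite (le_trans (ler_normD _ _))// normrZ [X in _ + X]normrZ.
have pmu : `|p *m M| <= C * mu.
  by rewrite (le_trans (HC _))// ler_wpM2l// /mu le_max lexx.
have qmu : `|q *m M| <= C * mu.
  by rewrite (le_trans (HC _))// ler_wpM2l// /mu le_max lexx orbT.
have mu0 : 0 <= mu by rewrite /mu le_max normr_ge0.
have th : theta + -1 = h by rewrite /theta addrC addKr.
have tVh : `|theta^-1 + -1| <= h.
  have -> : theta^-1 + -1 = - (h / theta).
    by rewrite /theta; field; rewrite gt_eqF.
  rewrite normrN ger0_norm; last by rewrite divr_ge0// ltW.
  by rewrite ler_pdivrMr// ler_peMr ?ltW// /theta ltrDl.
rewrite th (gtr0_norm h0) (le_trans (lerD (ler_pM _ _ tVh pmu) (ler_wpM2l (ltW h0) qmu)))//.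
have -> : e = 2 * h * (C + 1) by rewrite /h; field; rewrite gt_eqF.
have := mulr_ge0 (ltW h0) mu0; lra.
Qed.

(* The points [theta^-k x M^(k + 1) + theta^(k - m) y M^(k - m - 1)], [0 <= k <= m], form a
   pseudo-orbit from a neighborhood of [x M] to a neighborhood of [y M^-1]. *)
Lemma NM_le_Nm_subexponential x y : x != 0 -> y != 0 ->
  (forall rho, 1 < rho -> exists C, forall k, `|x *m M ^+ k| <= C * rho ^+ k) ->
  (forall rho, 1 < rho -> exists C, forall k, `|y *m invmx M ^+ k| <= C * rho ^+ k) ->
  (NM y <= Nm x)%N.
Proof.
move=> x0 y0 Hx Hy; rewrite leqNgt; apply/negP => xy.
have [theta theta1 step] := Nm_le_NM_contraction xy.
have t0 : 0 < theta by exact: lt_trans theta1.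
have tV0 : theta^-1 != 0 by rewrite invr_neq0// gt_eqF.
have tk0 k : theta ^- k != 0 by rewrite invr_neq0// expf_neq0// gt_eqF.
(* Any rate strictly between 1 and [theta] serves. *)
pose rho := (1 + theta) / 2.
have rho1 : 1 < rho by rewrite /rho; lra.
have rt : 0 < rho < theta by rewrite /rho; apply/andP; split; lra.
have [Cx {}Hx] := Hx _ rho1; have [Cy {}Hy] := Hy _ rho1.
have xM0 : x *m M != 0 by exact: mulmx_unit_neq0.
have yM0 : y *m invmx M != 0 by rewrite mulmx_unit_neq0// unitmx_inv.
(* The induction generalizes over the backward summand [q] at the end of the pseudo-orbit; one step
   earlier it is [theta^-1 q M^-1], and going backward does not lower [NM]. *)
have orbit k q : q != 0 -> (NM y <= NM q)%N ->
    (Nm (theta ^- k *: (x *m M ^+ k.+1) + q) <=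
     NM (x *m M + theta ^- k *: (q *m invmx M ^+ k)))%N.
  elim: k q => [|k IH] q q0 yq.
    by rewrite !expr0 expr1 mulmx1 invr1 !scale1r Nm_le_NM.
  have qV0 : theta^-1 *: (q *m invmx M) != 0.
    by rewrite scaler_eq0 negb_or tV0 mulmx_unit_neq0// unitmx_inv.
  have yqV : (NM y <= NM (theta^-1 *: (q *m invmx M)))%N.
    rewrite (NMZ _ tV0); apply: leq_trans yq _.
    by have := NM_backward 1 q0; rewrite expr1.
  have := IH _ qV0 yqV.
  have -> : theta ^- k *: (theta^-1 *: (q *m invmx M) *m invmx M ^+ k) =
      theta ^- k.+1 *: (q *m invmx M ^+ k.+1).
    by rewrite (mulmx_exprS q) -scalemxAl scalerA (exprSr theta) invfM mulrC.
  apply: leq_trans; apply: leq_trans (Nm_le_NM _) _.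
  have := step (theta ^- k *: (x *m M ^+ k.+1)) (theta^-1 *: (q *m invmx M)).
  have -> : theta^-1 *: (theta ^- k *: (x *m M ^+ k.+1) *m M) =
      theta ^- k.+1 *: (x *m M ^+ k.+2).
    by rewrite (mulmx_exprSr x _ k.+1) -scalemxAl scalerA (exprS theta) invfM.
  have -> : theta *: (theta^-1 *: (q *m invmx M) *m M) = q.
    by rewrite -scalemxAl mulmxKV// scalerA divff ?scale1r// gt_eqF.
  apply; [|exact: yqV|].
    rewrite (mulmx_exprSr x) -scalemxAl (mulmxK Mu) (NmZ _ (tk0 k)); exact: Nm_forward.
  by rewrite scaler_eq0 negb_or tk0 mulmx_unit_neq0// unitmx_expr.
have near_x : \forall m \near \oo,
    (NM (x *m M + theta ^- m *: (y *m invmx M ^+ m.+1)) <= NM (x *m M))%N.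
  have lim0 := @geometric_decay _ _ _ _ _ (x *m M) rt Hy.
  have nearM : \forall z \near x *m M, (NM (z : 'rV[R]_n.+1) <= NM (x *m M))%N.
    by have := near_Nm_NM (x *m M); apply: filterS => z [].
  exact: (lim0 _ nearM).
have near_y : \forall m \near \oo,
    (Nm (y *m invmx M) <= Nm (y *m invmx M + theta ^- m *: (x *m M ^+ m.+1)))%N.
  have lim1 := @geometric_decay _ _ _ _ _ (y *m invmx M) rt Hx.
  have nearV : \forall z \near y *m invmx M, (Nm (y *m invmx M) <= Nm (z : 'rV[R]_n.+1))%N.
    by have := near_Nm_NM (y *m invmx M); apply: filterS => z [].
  exact: (lim1 _ nearV).
have [m [m_x m_y]] := filter_ex (filterI near_x near_y).
have y_yM : (NM y <= Nm (y *m invmx M))%N by have := NMM yM0; rewrite mulmxKV.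
(* The chain is: [NM y], [Nm (y M^-1)], [Nm] at the end of the pseudo-orbit, [NM] at its start,
   [NM (x M)], [Nm x], each at most the next. *)
have := orbit m _ yM0 (leq_trans y_yM (Nm_le_NM _)).
rewrite -mulmx_exprS addrC => h.
have := leq_trans (leq_trans (leq_trans y_yM m_y) h) (leq_trans m_x (NMM x0)).
by rewrite leqNgt xy.
Qed.

End Chain.

(** * Growth of orbits and moduli of eigenvalues *)

Section Growth.
Variables (K : numFieldType) (n : nat).
Implicit Types (N : 'M[K]_n.+1) (x : 'rV[K]_n.+1) (s : seq K).

Lemma mulmx_horner_cons N x l s :
  x *m horner_mx N (\prod_(z <- l :: s) ('X - z%:P)) =
  (x *m N - l *: x) *m horner_mx N (\prod_(z <- s) ('X - z%:P)).
Proof.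
rewrite big_cons rmorphM/= rmorphB/= horner_mx_X horner_mx_C.
by rewrite -mul_mx_scalar -mulmxBr -mulmxA.
Qed.

(* If [y = x N - l x] then [x N^(k+1) = l x N^k + y N^k]. *)
Lemma power_growth N x s (rho : K) : (forall l, l \in s -> `|l| < rho) ->
  x *m horner_mx N (\prod_(z <- s) ('X - z%:P)) = 0 ->
  exists2 C, 0 <= C & forall k j, `|(x *m N ^+ k) 0 j| <= C * rho ^+ k.
Proof.
elim: s x => [|l s IH] x.
  rewrite big_nil rmorph1 mulmx1 => _ ->; exists 0 => // k j.
  by rewrite mul0mx mxE normr0 mul0r.
move=> sl; rewrite mulmx_horner_cons => /IH[|C C0 HC].
  by move=> z zs; apply: sl; rewrite inE zs orbT.
have lrho : `|l| < rho by rewrite sl// mem_head.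
have rho0 : 0 <= rho by rewrite (le_trans _ (ltW lrho)).
have d0 : 0 < rho - `|l| by rewrite subr_gt0.
(* The first summand covers [k = 0]; the second gives [C <= D (rho - |l|)], that is
   [|l| D + C <= D rho], which closes the induction. *)
exists (\sum_j `|x 0 j| + C / (rho - `|l|)).
  by rewrite addr_ge0 ?sumr_ge0// divr_ge0// ltW.
set D := _ + _.
elim=> [|k IHk] j.
  rewrite !expr0 mulmx1 mulr1 ler_wpDr//; first by rewrite divr_ge0// ltW.
  by rewrite (bigD1 j)//= lerDl sumr_ge0.
have -> : x *m N ^+ k.+1 = l *: (x *m N ^+ k) + (x *m N - l *: x) *m N ^+ k.
  by rewrite mulmx_exprS mulmxBl -scalemxAl addrC subrK.
rewrite mxE [X in X + _]mxE.
rewrite (le_trans (ler_normD _ _))// normrM.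
rewrite (le_trans (lerD (ler_wpM2l (normr_ge0 l) (IHk j)) (HC k j)))//.
have -> : `|l| * (D * rho ^+ k) + C * rho ^+ k = (`|l| * D + C) * rho ^+ k by ring.
have -> : D * rho ^+ k.+1 = D * rho * rho ^+ k by rewrite exprS mulrA.
rewrite ler_wpM2r ?exprn_ge0// -lerBrDl.
have -> : D * rho - `|l| * D = D * (rho - `|l|) by ring.
by rewrite -ler_pdivrMr// /D ler_wpDl// sumr_ge0.
Qed.

(** Each factor is inverted through [x N^-1 - l^-1 x = - l^-1 (x N - l x) N^-1], and [N^-1] commutes
    with its own polynomials. *)
Lemma horner_invmx N x s : N \in unitmx -> 0 \notin s ->
  x *m horner_mx N (\prod_(z <- s) ('X - z%:P)) = 0 ->
  x *m horner_mx (invmx N) (\prod_(z <- [seq z^-1 | z <- s]) ('X - z%:P)) = 0.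
Proof.
move=> Nu; elim: s x => [|l s IH] x; first by rewrite !big_nil !rmorph1.
rewrite inE negb_or eq_sym => /andP[l0 s0]; rewrite map_cons !mulmx_horner_cons => /(IH _ s0).
set V := invmx N; set q := \prod_(z <- _) _; set H := horner_mx V q => yH.
have -> : x *m V - l^-1 *: x = - l^-1 *: ((x *m N - l *: x) *m V).
  rewrite mulmxBl mulmxK// -scalemxAl scalerBr scalerA mulNr mulVf// scaleN1r opprK.
  by rewrite scaleNr addrC.
have VH : V *m H = H *m V.
  have : horner_mx V ('X * q) = horner_mx V (q * 'X) by rewrite mulrC.
  by rewrite !rmorphM/= horner_mx_X.
by rewrite -scalemxAl -mulmxA VH mulmxA yH mul0mx scaler0.
Qed.

End Growth.

(** * Real quadratic factors and growth rates *)

Section ComplexModuli.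
Variable R : realType.
Implicit Types l z : R[i].

(** The modulus as an element of [R]; the library norm of [l] lies in [R[i]]. *)
Definition cabs l : R := Num.sqrt (complex.Re l ^+ 2 + complex.Im l ^+ 2).

Lemma cabsE l : `|l| = real_complex R (cabs l).
Proof. exact: normc_def. Qed.

Lemma cabs_conj l : cabs (conjc l) = cabs l.
Proof. by case: l => a b; rewrite /cabs/= sqrrN. Qed.

Lemma cabs_gt0 l : l != 0 -> 0 < cabs l.
Proof. by move=> l0; rewrite -ltcR -cabsE rmorph0 normr_gt0. Qed.

Lemma norm_real_complex (a : R) : `|real_complex R a| = real_complex R `|a|.
Proof. by rewrite cabsE /cabs/= expr0n addr0 sqrtr_sqr. Qed.

(** The real polynomial with roots [l] and its conjugate. For real [l] it is the square of [X - l],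
    so real and nonreal eigenvalues are treated alike. *)
Definition quad l : {poly R} :=
  'X^2 - (2 * complex.Re l) *: 'X + (complex.Re l ^+ 2 + complex.Im l ^+ 2)%:P.

Lemma map_quad l :
  map_poly (real_complex R) (quad l) = ('X - l%:P) * ('X - (conjc l)%:P).
Proof.
rewrite /quad rmorphD rmorphB/= map_polyXn map_polyZ/= map_polyX map_polyC/=.
have -> : real_complex R (2 * complex.Re l) = l + conjc l.
  by case: l => a b; apply/eqP; rewrite eq_complex/= addrN mulr_natl mulr2n !eqxx.
have -> : real_complex R (complex.Re l ^+ 2 + complex.Im l ^+ 2) = l * conjc l.
  case: l => a b; apply/eqP; rewrite eq_complex/=; apply/andP; split; apply/eqP; ring.
by rewrite -mul_polyC polyCD polyCM; ring.
Qed.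

(** Both roots of [quad l] have modulus [cabs l], so distinct moduli exclude a common root. *)
Lemma coprimep_quad l z : cabs l != cabs z -> coprimep (quad l) (quad z).
Proof.
move=> lz; rewrite -(coprimep_map (real_complex R)) !map_quad.
rewrite coprimepMl !coprimepMr !coprimep_XsubC !root_XsubC.
have ne u v : cabs u = cabs l -> cabs v = cabs z -> v != u.
  by move=> ul vz; apply: contra lz => /eqP vu; rewrite -ul -vz vu.
by rewrite !ne// cabs_conj.
Qed.

Lemma coprimep_prod_quad (s1 s2 : seq R[i]) (P1 P2 : pred R[i]) :
  (forall l z, P1 l -> P2 z -> cabs l != cabs z) ->
  coprimep (\prod_(l <- s1 | P1 l) quad l) (\prod_(z <- s2 | P2 z) quad z).
Proof.
move=> P12; elim/big_ind : _ => [|p q cp cq|l Pl]; first exact: coprime1p.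
  by rewrite coprimepMl cp.
elim/big_ind : _ => [|p q cp cq|z Pz]; first exact: coprimep1.
  by rewrite coprimepMr cp.
by apply: coprimep_quad; exact: P12.
Qed.

Lemma map_prod_quad (s : seq R[i]) (P : pred R[i]) :
  map_poly (real_complex R) (\prod_(l <- s | P l) quad l) =
  \prod_(l <- [seq z <- s | P z] ++ [seq conjc z | z <- s & P z]) ('X - l%:P).
Proof.
rewrite rmorph_prod/= (eq_bigr _ (fun l _ => map_quad l)) big_split/=.
by rewrite big_cat/= big_map !big_filter.
Qed.

Variable n : nat.
Implicit Types (M : 'M[R]_n.+1) (x y : 'rV[R]_n.+1).

Lemma map_mx_expr M k :
  map_mx (real_complex R) M ^+ k = map_mx (real_complex R) (M ^+ k).
Proof. by rewrite -[LHS](rmorphXn (map_mx (real_complex R))). Qed.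

(** A nonnegative element of [R[i]] is real, so an entrywise bound over [R[i]] descends to [R]. *)
Lemma norm_le_complex_bound (u : nat -> 'rV[R]_n.+1) (C : R[i]) (rho : R) : 0 <= rho ->
  0 <= C ->
  (forall k j, `|real_complex R (u k 0 j)| <= C * real_complex R rho ^+ k) ->
  forall k, `|u k| <= complex.Re C * rho ^+ k.
Proof.
move=> rho0 C0 H k.
have CE : C = real_complex R (complex.Re C).
  by apply/eqP; rewrite eq_complex/= eqxx -(ger0_Im C0) /=.
have Re0 : 0 <= complex.Re C by rewrite -lecR -CE rmorph0.
apply: norm_le_coord => [|j]; first by rewrite mulr_ge0// exprn_ge0.
by rewrite -lecR -norm_real_complex rmorphM rmorphXn/= -CE; exact: H.
Qed.

Lemma kermxpoly_growth M x (s : seq R[i]) (P : pred R[i]) (rho : R) : 0 <= rho ->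
  (forall l, l \in s -> P l -> cabs l < rho) ->
  (x <= kermxpoly M (\prod_(l <- s | P l) quad l))%MS ->
  exists C, forall k, `|x *m M ^+ k| <= C * rho ^+ k.
Proof.
move=> rho0 srho /sub_kermxP/(congr1 (map_mx (real_complex R))).
rewrite map_mxM map_mx0 map_horner_mx map_prod_quad => eq0.
have [|C C0 HC] := power_growth (rho := real_complex R rho) _ eq0.
  move=> l; rewrite mem_cat cabsE ltcR => /orP[|/mapP[z +]].
    by rewrite mem_filter => /andP[Pl ls]; exact: srho.
  by rewrite mem_filter => /andP[Pl ls] ->; rewrite cabs_conj; exact: srho.
exists (complex.Re C); apply: norm_le_complex_bound => // k j.
by have := HC k j; rewrite map_mx_expr -map_mxM mxE.
Qed.

Lemma kermxpoly_growth_inv M x (s : seq R[i]) (P : pred R[i]) (rho : R) : 0 < rho ->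
  M \in unitmx ->
  (forall l, l \in s -> P l -> rho^-1 < cabs l) ->
  (x <= kermxpoly M (\prod_(l <- s | P l) quad l))%MS ->
  exists C, forall k, `|x *m invmx M ^+ k| <= C * rho ^+ k.
Proof.
move=> rho0 Mu srho /sub_kermxP/(congr1 (map_mx (real_complex R))).
rewrite map_mxM map_mx0 map_horner_mx map_prod_quad.
set t := _ ++ _.
have tP l : l \in t -> rho^-1 < cabs l.
  rewrite mem_cat => /orP[|/mapP[z +]].
    by rewrite mem_filter => /andP[Pl ls]; exact: srho.
  by rewrite mem_filter => /andP[Pl ls] ->; rewrite cabs_conj; exact: srho.
have t0 : 0 \notin t.
  apply/negP => /tP; rewrite /cabs/= expr0n addr0 sqrtr0 ltNge.
  by rewrite invr_ge0 ltW.
have MCu : map_mx (real_complex R) M \in unitmx by rewrite map_unitmx.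
move=> /(horner_invmx MCu t0) eq0.
have [|C C0 HC] := power_growth (rho := real_complex R rho) _ eq0.
  move=> _ /mapP[z /tP zt ->]; rewrite normfV cabsE.
  rewrite invf_plt ?posrE ?ltcR//; last by rewrite (lt_trans _ zt)// invr_gt0.
  by rewrite -fmorphV ltcR.
exists (complex.Re C); apply: norm_le_complex_bound => //; first exact: ltW.
by move=> k j; have := HC k j; rewrite -map_invmx map_mx_expr -map_mxM mxE.
Qed.

End ComplexModuli.

(** * Spectral splitting *)

Section Splitting.
Variables (R : realType) (n : nat) (M : 'M[R]_n.+1).
Hypothesis Mu : M \in unitmx.
Hypothesis NMM : forall x : 'rV[R]_n.+1, x != 0 -> (NM (x *m M) <= Nm x)%N.
Implicit Types (x y : 'rV[R]_n.+1).

(** Dividing [M] by [r] makes the forward orbit of [x] and the backward orbit of [y] subexponential,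
    and a nonzero factor does not affect [Nm] and [NM]. *)
Lemma NM_le_Nm_moduli (s1 s2 : seq R[i]) (Q1 Q2 : pred R[i]) (r : R) x y :
  0 < r -> x != 0 -> y != 0 ->
  (forall l, l \in s1 -> Q1 l -> cabs l <= r) ->
  (x <= kermxpoly M (\prod_(l <- s1 | Q1 l) quad l))%MS ->
  (forall l, l \in s2 -> Q2 l -> r <= cabs l) ->
  (y <= kermxpoly M (\prod_(l <- s2 | Q2 l) quad l))%MS ->
  (NM y <= Nm x)%N.
Proof.
move=> r0 x0 y0 s1r xs s2r ys.
have rV0 : r^-1 != 0 by rewrite invr_neq0// gt_eqF.
have Mu' : r^-1 *: M \in unitmx by rewrite unitmxZ// unitfE.
have NMM' z : z != 0 -> (NM (z *m (r^-1 *: M)) <= Nm z)%N.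
  by move=> /NMM; rewrite -scalemxAr NMZ.
apply: (NM_le_Nm_subexponential Mu' NMM' x0 y0) => rho rho1.
  have [|l ls Ql|C HC] := kermxpoly_growth (rho := r * rho) _ _ xs.
  - by rewrite mulr_ge0 ?ltW// (lt_trans _ rho1).
  - by rewrite (le_lt_trans (s1r _ ls Ql))// ltr_pMr.
  exists C => k; rewrite exprZn -scalemxAr normrZ exprVn ger0_norm; last first.
    by rewrite invr_ge0 exprn_ge0// ltW.
  rewrite ler_pdivrMl ?exprn_gt0// (le_trans (HC k))// exprMn.
  by rewrite le_eqVlt; apply/orP; left; apply/eqP; ring.
have [|l ls Ql|C HC] := kermxpoly_growth_inv (rho := rho / r) _ Mu _ ys.
- by rewrite divr_gt0// (lt_trans _ rho1).
- rewrite invf_div (lt_le_trans _ (s2r _ ls Ql))// ltr_pdivrMr ?ltr_pMr//.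
  by rewrite (lt_trans _ rho1).
exists C => k; rewrite invmxZ ?unitfE// invrK exprZn -scalemxAr normrZ ger0_norm; last first.
  by rewrite exprn_ge0// ltW.
apply: le_trans (ler_wpM2l (exprn_ge0 k (ltW r0)) (HC k)) _.
by rewrite expr_div_n mulrCA [r ^+ k * _]mulrC mulfVK// expf_neq0// gt_eqF.
Qed.

End Splitting.

(** * Dimension bounds and eigenvalues of restrictions *)

Lemma exists_vanishing (F : fieldType) (n m : nat) (W : 'M[F]_n) (f : 'I_m -> 'I_n) :
  (m < \rank W)%N ->
  exists x : 'rV[F]_n, [/\ x != 0, (x <= W)%MS & forall j, x 0 (f j) = 0].
Proof.
move=> mW; pose B := \matrix_(i, j) (i == f j)%:R : 'M[F]_(n, m).
have : kermx (row_base W *m B) != 0.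
  by rewrite kermx_eq0 -row_leq_rank -ltnNge (leq_ltn_trans (rank_leq_col _)).
move=> /rowV0Pn[u /sub_kermxP uB u0]; exists (u *m row_base W); split.
- by rewrite mulmx_free_eq0 ?row_base_free.
- by rewrite (submx_trans (submxMl _ _))// eq_row_base.
move=> j; have := congr1 (fun x : 'rV_m => x 0 j) uB; rewrite mulmxA mxE [RHS]mxE => <-.
rewrite (bigD1 (f j))//= [B _ _]mxE eqxx mulr1 big1 ?addr0// => i ij.
by rewrite [B _ _]mxE (negPf ij) mulr0.
Qed.

Lemma rank_le2_of_calN (R : realType) (n : nat) (W : 'M[R]_n.+1) :
  (forall x : 'rV[R]_n.+1, (x <= W)%MS -> x != 0 -> calN x) -> (\rank W <= 2)%N.
Proof.
move=> WN; rewrite leqNgt; apply/negP => rW.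
have := rank_leq_row W; case: n W WN rW => [|[|n]] W WN rW.
- by rewrite leqNgt (leq_trans _ rW).
- by rewrite leqNgt rW.
move=> _; have [x [x0 xW xf]] :=
  exists_vanishing (fun j : 'I_2 => if j == ord0 then ord0 else ordS ord0) rW.
have := Nm_lt_NM (xf ord0) (xf (lift ord0 ord0)).
by rewrite (WN x xW x0) ltnn.
Qed.

Lemma rank_le1_of_Nm_max (R : realType) (n : nat) (W : 'M[R]_n.+1) : (0 < n)%N ->
  (forall x : 'rV[R]_n.+1, (x <= W)%MS -> x != 0 -> Nm x = n.+1) -> (\rank W <= 1)%N.
Proof.
case: n W => // n W _ WN; rewrite leqNgt; apply/negP => rW.
have [x [x0 xW xf]] := exists_vanishing (fun=> ord0) rW.
by have := Nm_lt_dim (xf ord0); rewrite WN// ltnn.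
Qed.

Lemma eq_of_leq_sum (I : finType) (f g : I -> nat) : (forall i, f i <= g i)%N ->
  (\sum_i f i = \sum_i g i)%N -> forall i, f i = g i.
Proof.
move=> fg /eqP; have [_ ->] := leqif_sum (fun i (_ : predT i) => leqif_eq (fg i)).
by move=> /forallP fg_eq i; apply/eqP; exact: fg_eq.
Qed.

(** The total of the upper bounds on the block dimensions. When [b] is the parity of the dimension
    of the space, it equals that dimension. *)
Lemma sum_block_dims (p : nat) (b : bool) : (0 < p)%N ->
  (\sum_(i < p) (if b && (i.+1 == p) then 1 else 2) = p.*2 - b)%N.
Proof.
case: p => // p _; rewrite big_ord_recr/= eqxx andbT (eq_bigr (fun=> 2%N)).
  by rewrite sum_nat_const card_ord; case: b; lia.
by move=> i _; rewrite eqSS ltn_eqF ?andbF.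
Qed.

Lemma exists_argmax (R : realType) (T : eqType) (f : T -> R) (s : seq T) : s != [::] ->
  exists2 x, x \in s & forall y, y \in s -> f y <= f x.
Proof.
elim: s => // a s IH _; have [->|/IH[x xs xmax]] := eqVneq s [::].
  by exists a; rewrite ?mem_head// => y; rewrite inE => /eqP ->.
have [fax|/ltW fxa] := leP (f a) (f x).
  exists x; first by rewrite inE xs orbT.
  by move=> y; rewrite inE => /predU1P[->//|/xmax].
exists a; first exact: mem_head.
by move=> y; rewrite inE => /predU1P[->//|/xmax/le_trans]; apply.
Qed.

Lemma exists_argmin (R : realType) (T : eqType) (f : T -> R) (s : seq T) : s != [::] ->
  exists2 x, x \in s & forall y, y \in s -> f x <= f y.
Proof.
move=> /(exists_argmax (fun x => - f x))[x xs xmax]; exists x => // y /xmax.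
by rewrite lerN2.
Qed.

Lemma kermxpoly_dvdp (F : fieldType) (n : nat) (M : 'M[F]_n.+1) (p q : {poly F}) :
  p %| q -> (kermxpoly M p <= kermxpoly M q)%MS.
Proof.
move=> /dvdpP[s ->]; rewrite mulrC; apply/sub_kermxP; rewrite rmorphM/=.
by rewrite -[_ * _]/(_ *m _) mulmxA mulmx_ker mul0mx.
Qed.

Lemma dvdp_prod_subset (F : fieldType) (T : Type) (s : seq T) (Q1 Q2 : pred T)
    (f : T -> {poly F}) : subpred Q1 Q2 ->
  \prod_(l <- s | Q1 l) f l %| \prod_(l <- s | Q2 l) f l.
Proof.
move=> Q12; rewrite [X in _ %| X](bigID Q1)/= dvdp_mulr//.
rewrite (eq_bigl Q1)// => l; case Ql : (Q1 l); last by rewrite andbF.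
by rewrite Q12.
Qed.

Lemma horner_mx_eigen (F : fieldType) (n : nat) (A : 'M[F]_n.+1) (v : 'rV[F]_n.+1) l p :
  v *m A = l *: v -> v *m horner_mx A p = p.[l] *: v.
Proof.
move=> vA; elim/poly_ind: p => [|p c IH].
  by rewrite rmorph0 mulmx0 horner0 scale0r.
rewrite rmorphD rmorphM/= horner_mx_X horner_mx_C mulmxDr mul_mx_scalar.
rewrite -[_ * A]/(_ *m A) mulmxA IH -scalemxAl vA scalerA -scalerDl.
by rewrite hornerD hornerM hornerX hornerC.
Qed.

Lemma exists_extremal_moduli (R : realType) (m : nat) (A : 'M[R]_m) : (0 < m)%N ->
  exists r, is_min_modulus A r.1 /\ is_max_modulus A r.2.
Proof.
move=> m0; set AC := map_mx (real_complex R) A.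
have [s sE] := closed_field_poly_normal (char_poly AC).
rewrite (monicP (char_poly_monic _)) scale1r in sE.
have eigE l : eigenvalue AC l = (l \in s) by rewrite eigenvalue_root_char sE root_prod_XsubC.
have s0 : s != [::].
  apply: contraTneq m0 => s0; have := size_char_poly AC.
  by rewrite sE s0 big_nil size_poly1 => -[<-].
have [l ls lmin] := exists_argmin (@cabs R) s0.
have [z zs zmax] := exists_argmax (@cabs R) s0.
exists (cabs l, cabs z); split; split=> /=.
- by exists l; [rewrite eigE|exact: cabsE].
- by move=> w; rewrite eigE cabsE lecR => /lmin.
- by exists z; [rewrite eigE|exact: cabsE].
- by move=> w; rewrite eigE cabsE lecR => /zmax.
Qed.

(** An eigenvector of the restriction, written in the ambient space, is an eigenvector of the
    complexified [M] killed by the product polynomial; so [l] is a root, that is, some [z] or its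
    conjugate. *)
Lemma eigenvalue_restrictmx_prod_quad (R : realType) (n : nat) (M W : 'M[R]_n.+1)
    (s : seq R[i]) (Q : pred R[i]) (l : R[i]) :
  stablemx W M -> (W <= kermxpoly M (\prod_(z <- s | Q z) quad z))%MS ->
  eigenvalue (map_mx (real_complex R) (restrictmx W M)) l ->
  exists z, [/\ z \in s, Q z & cabs l = cabs z].
Proof.
move=> Wst WQ /eigenvalueP[v vl v0].
pose V := map_mx (real_complex R) (row_base W).
pose MC := map_mx (real_complex R) M.
have Vfree : row_free V by rewrite /V row_free_map row_base_free.
have u0 : v *m V != 0 by rewrite mulmx_free_eq0.
have ul : v *m V *m MC = l *: (v *m V).
  rewrite [RHS]scalemxAl -vl -!mulmxA -map_mxM; congr (v *m _).
  rewrite -map_mxM /conjmx mulmxKpV//.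
  by rewrite (eqmxMr _ (eq_row_base W)) eq_row_base.
have : v *m V *m horner_mx MC (map_poly (real_complex R) (\prod_(z <- s | Q z) quad z)) = 0.
  have W0 : row_base W *m horner_mx M (\prod_(z <- s | Q z) quad z) = 0.
    by apply/sub_kermxP; apply: submx_trans WQ; rewrite eq_row_base.
  by rewrite -map_horner_mx -mulmxA -map_mxM W0 map_mx0 mulmx0.
rewrite (horner_mx_eigen _ ul) => /eqP; rewrite scaler_eq0 (negPf u0) orbF.
rewrite -rootE map_prod_quad root_prod_XsubC mem_cat => /orP[|/mapP[z +]].
  by rewrite mem_filter => /andP[Ql ls]; exists l.
by rewrite mem_filter => /andP[Qz zs] ->; exists z; rewrite cabs_conj.
Qed.

(** * The invariant splitting *)

Section Decomposition.
Variables (R : realType) (n : nat) (M : 'M[R]_n.+1).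
Hypothesis Mu : M \in unitmx.
Hypothesis NMM : forall x : 'rV[R]_n.+1, x != 0 -> (NM (x *m M) <= Nm x)%N.
Implicit Types (x y : 'rV[R]_n.+1) (l z : R[i]).

Let MC := map_mx (real_complex R) M.

Let rs : seq R[i] := sval (closed_field_poly_normal (char_poly MC)).

Let char_poly_rs : char_poly MC = \prod_(l <- rs) ('X - l%:P).
Proof.
rewrite /rs; case: closed_field_poly_normal => s /= {1}->.
by rewrite (monicP (char_poly_monic _)) scale1r.
Qed.

Let det_root l : l \in rs -> \det (MC - l%:M) = 0.
Proof.
move=> lrs; have : root (char_poly MC) l by rewrite char_poly_rs root_prod_XsubC.
rewrite -eigenvalue_root_char => /eigenvalueP[v vM v0].
apply/eqP/det0P; exists v => //.
by rewrite mulmxBr vM mul_mx_scalar subrr.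
Qed.

Let root_neq0 l : l \in rs -> l != 0.
Proof.
move=> /det_root; apply: contra_eqN => /eqP ->.
rewrite raddf0 subr0 -unitfE -[_ \is a GRing.unit]unitmxE /MC.
by rewrite map_unitmx.
Qed.

Let kermx_quad_neq0 l : l \in rs -> kermxpoly M (quad l) != 0.
Proof.
move=> lrs; rewrite kermx_eq0 row_free_unit unitmxE unitfE negbK.
rewrite -(fmorph_eq0 (real_complex R)) -det_map_mx map_horner_mx map_quad rmorphM/=.
rewrite -[_ * _]/(_ *m _) det_mulmx rmorphB/= horner_mx_X horner_mx_C.
by rewrite det_root// mul0r.
Qed.

(** Over [R[i]] the characteristic polynomial is a factor of this product, so Cayley-Hamilton
    applies. *)
Let prod_quad_annihilates : horner_mx M (\prod_(l <- rs) quad l) = 0.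
Proof.
apply: (map_mx_inj (f := real_complex R)).
rewrite map_mx0 map_horner_mx map_prod_quad big_cat/= filter_predT.
by rewrite rmorphM/= -char_poly_rs Cayley_Hamilton mul0r.
Qed.

(** The real sum of the generalized eigenspaces of modulus [r]; below, [c r] reads the value of [N]
    there off a single vector. *)
Let E r := kermxpoly M (\prod_(l <- rs | cabs l == r) quad l).
Let c r := Nm (nz_row (E r)).

Let E_neq0 l : l \in rs -> nz_row (E (cabs l)) != 0.
Proof.
move=> lrs; rewrite nz_row_eq0; apply: contra (kermx_quad_neq0 lrs) => /eqP E0.
rewrite -submx0 -E0 kermxpoly_dvdp// (big_rem l lrs)/= eqxx.
exact: dvdp_mulr.
Qed.

(** The lower bound compares [x] with the [E] of largest modulus selected by [Q], the upper bound
    with that of smallest modulus. *)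
Let Nm_range x (Q : pred R[i]) (a b : nat) : x != 0 ->
  (x <= kermxpoly M (\prod_(l <- rs | Q l) quad l))%MS ->
  (forall l, l \in rs -> Q l -> a <= c (cabs l) <= b)%N ->
  (a <= Nm x)%N /\ (NM x <= b)%N.
Proof.
move=> x0 xQ cab; have sQ : [seq l <- rs | Q l] != [::].
  apply: contra x0 => /eqP s0; move: xQ.
  by rewrite -big_filter s0 big_nil kermxpoly1 submx0.
split.
  have [l + lmax] := exists_argmax (@cabs R) sQ; rewrite mem_filter => /andP[Ql lrs].
  have /andP[ac _] := cab _ lrs Ql; apply: leq_trans ac _; apply: leq_trans (Nm_le_NM _) _.
  apply: (NM_le_Nm_moduli Mu NMM (cabs_gt0 (root_neq0 lrs)) x0 (E_neq0 lrs) _ xQ _ (nz_row_sub _)).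
    by move=> z zrs Qz; apply: lmax; rewrite mem_filter Qz.
  by move=> z zrs /eqP ->.
have [l + lmin] := exists_argmin (@cabs R) sQ; rewrite mem_filter => /andP[Ql lrs].
have /andP[_ cb] := cab _ lrs Ql; apply: leq_trans cb.
apply: (NM_le_Nm_moduli Mu NMM (cabs_gt0 (root_neq0 lrs)) (E_neq0 lrs) x0 _ (nz_row_sub _) _ xQ).
  by move=> z zrs /eqP ->.
by move=> z zrs Qz; apply: lmin; rewrite mem_filter Qz.
Qed.

Let c_antitone l z : l \in rs -> z \in rs -> cabs l <= cabs z -> (c (cabs z) <= c (cabs l))%N.
Proof.
move=> lrs zrs lz; apply: leq_trans (Nm_le_NM _) _.
apply: (NM_le_Nm_moduli Mu NMM (cabs_gt0 (root_neq0 zrs)) (E_neq0 lrs) (E_neq0 zrs)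
  _ (nz_row_sub _) _ (nz_row_sub _)).
  by move=> w wrs /eqP ->.
by move=> w wrs /eqP ->.
Qed.

Let p := (ntilde n.+1).+1./2.

(** Oddness and the bound by the dimension hold for every vector, so [idx] is defined for all [l],
    eigenvalue or not. *)
Let c_index : exists idx : R[i] -> 'I_p, forall l, c (cabs l) = (2 * idx l).+1.
Proof.
suff /choice[idx idxE] : forall l, exists i : 'I_p, c (cabs l) = (2 * i).+1 by exists idx.
move=> l; have := odd_Nm (nz_row (E (cabs l))).
have := leq_trans (Nm_le_NM _) (NM_le (nz_row (E (cabs l)))).
rewrite -/(c (cabs l)) => cn codd.
have ip : ((c (cabs l)).-1./2 < p)%N.
  by rewrite /p /ntilde; case: ifP => nodd; lia.
by exists (Ordinal ip) => /=; lia.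
Qed.

Lemma feedback_decomposition : (0 < n)%N ->
  exists W : 'I_p -> 'M[R]_n.+1,
    (forall i, stablemx (W i) M) /\
    (forall i : 'I_p, (i.+1 <= (ntilde n.+1).-1./2)%N -> \rank (W i) = 2%N) /\
    (forall i : 'I_p, i.+1 = p -> \rank (W i) = (if odd n.+1 then 1 else 2)%N) /\
    mxdirect (\sum_i W i) /\
    (\sum_i W i == 1%:M)%MS /\
    (forall (i : 'I_p) (x : 'rV[R]_n.+1), (x <= W i)%MS -> x != 0 ->
       calN x /\ extN x = (2 * i).+1) /\
    (forall (h k : 'I_p) (x : 'rV[R]_n.+1), (h <= k)%N ->
       x != 0 -> (x <= \sum_(i : 'I_p | (h <= i <= k)%N) W i)%MS ->
       ((2 * h).+1 <= Nm x)%N /\ (NM x <= (2 * k).+1)%N) /\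
    exists nu mu : 'I_p -> R,
      (forall i, is_min_modulus (restrictmx (W i) M) (nu i)) /\
      (forall i, is_max_modulus (restrictmx (W i) M) (mu i)) /\
      (forall i, nu i <= mu i) /\
      (forall i j : 'I_p, (j : nat) = i.+1 -> mu j < nu i).
Proof.
move=> n0; have [idx idxE] := c_index.
pose q i := \prod_(l <- rs | idx l == i) quad l.
pose W i := kermxpoly M (q i).
(* Since [idx] depends only on the modulus, different blocks involve different moduli, which makes
   the polynomials [q i] pairwise coprime. *)
have idx_cabs l z : cabs l = cabs z -> idx l = idx z.
  by move=> lz; apply: val_inj => /=; have := idxE l; rewrite lz idxE => -[]; lia.
have q_coprime : {in predT &, forall i j, j != i -> coprimep (q i) (q j)}.
  move=> i j _ _ ji; apply: coprimep_prod_quad => l z /eqP li /eqP zj.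
  by apply: contra ji => /eqP/idx_cabs lz; rewrite -li -zj lz.
have Wst i : stablemx (W i) M by apply: comm_mx_stable_kermxpoly.
have Wdirect : mxdirect (\sum_i W i) by apply: mxdirect_sum_kermx.
have Wfull : (\sum_i W i :=: 1%:M)%MS.
  apply: eqmx_trans (eqmx_sym (kermxpoly_prod _ q_coprime)) _.
  have -> : \prod_i q i = \prod_(l <- rs) quad l by rewrite [RHS](partition_big idx predT).
  by rewrite /kermxpoly prod_quad_annihilates; exact: kermx0.
have Wrange (h k : 'I_p) x : x != 0 -> (x <= \sum_(i : 'I_p | (h <= i <= k)%N) W i)%MS ->
    ((2 * h).+1 <= Nm x)%N /\ (NM x <= (2 * k).+1)%N.
  move=> x0 xW; apply: (Nm_range (Q := fun l => (h <= idx l <= k)%N) x0); last first.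
    by move=> l _; rewrite idxE; lia.
  apply: submx_trans xW _; apply/sumsmx_subP => i hik.
  by apply: kermxpoly_dvdp; apply: dvdp_prod_subset => l /eqP ->.
have WN (i : 'I_p) x : (x <= W i)%MS -> x != 0 -> calN x /\ extN x = (2 * i).+1.
  move=> xW x0; have [|lo hi] := Wrange i i x x0.
    by apply: submx_trans xW _; rewrite (sumsmx_sup i)// leqnn.
  by have := Nm_le_NM x; split; [rewrite /calN/=|rewrite /extN]; lia.
have sum_rank : (\sum_i \rank (W i) = n.+1)%N.
  by rewrite -(mxdirectP Wdirect)/= Wfull mxrank1.
pose d (i : 'I_p) := (if odd n.+1 && (i.+1 == p) then 1 else 2)%N.
have rank_le i : (\rank (W i) <= d i)%N.
  rewrite /d; case: ifP => [/andP[nodd /eqP ip]|_]; last first.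
    by apply: rank_le2_of_calN => x xW x0; have [] := WN i x xW x0.
  apply: rank_le1_of_Nm_max n0 _ => x xW x0; have [_] := WN i x xW x0; rewrite /extN => ->.
  have pE : p = n.+2./2 by rewrite /p /ntilde nodd.
  by move: ip; move: (nat_of_ord i) => k kp; lia.
have rankE : forall i, \rank (W i) = d i.
  apply: eq_of_leq_sum rank_le _; rewrite sum_rank sum_block_dims.
    by rewrite /p /ntilde; case: ifP => nodd; lia.
  by rewrite /p /ntilde; case: ifP => nodd; lia.
have rank_gt0 i : (0 < \rank (W i))%N by rewrite rankE /d; case: ifP.
have /choice[r Hr] i := exists_extremal_moduli (restrictmx (W i) M) (rank_gt0 i).
exists W; split=> //; split; [|split; [|split=> //; split; [|split=> //; split=> [h k x _|]]]].
- move=> i ip; rewrite rankE /d; case: ifP => // /andP[nodd /eqP].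
  have nt : ntilde n.+1 = n.+1 by rewrite /ntilde nodd.
  have pE : p = n.+2./2 by rewrite /p nt.
  by move: ip; rewrite nt; move: (nat_of_ord i) => k; lia.
- by move=> i ip; rewrite rankE /d ip eqxx andbT.
- exact/eqmxP.
- exact: Wrange.
exists (fun i => (r i).1), (fun i => (r i).2).
split; [by move=> i; have [] := Hr i|split; [by move=> i; have [] := Hr i|split]].
  move=> i; have [[[l lev lE] _] [_ rmax]] := Hr i.
  by rewrite -lecR -lE; exact: rmax.
have modulusE i l : eigenvalue (map_mx (real_complex R) (restrictmx (W i) M)) l ->
    exists z, [/\ z \in rs, idx z = i & cabs l = cabs z].
  move=> /(eigenvalue_restrictmx_prod_quad (Wst i) (submx_refl _))[z [zs /eqP zi lz]].
  by exists z.
move=> i j ji; have [[[l /modulusE[z [zs zi lz]] lE] _] _] := Hr i.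
have [_ [[w /modulusE[w' [ws wj ww]] wE] _]] := Hr j.
rewrite -ltcR -lE -wE !cabsE ltcR lz ww ltNge; apply/negP => /(c_antitone zs ws).
by rewrite !idxE zi wj ji; lia.
Qed.

End Decomposition.

(** * The fundamental matrix *)

Section FundamentalMatrix.
Variables (R : realType) (n : nat) (a : 'I_n.+1 -> 'I_n.+1 -> R -> R).
Variable Phi : R -> 'M[R]_n.+1.
Hypothesis ha : cyclic_negative_feedback a.
Hypothesis hPhi : fundamental_matrix a Phi.
Implicit Types v : 'rV[R]_n.+1.

Let diag_cont i : continuous (a i i). Proof. by case: ha => h _ _ _; exact: h. Qed.

Let offdiag_cont i : continuous (a i (ord_pred i)).
Proof. by case: ha => _ h _ _; exact: h. Qed.

Let delta_offdiag_gt0 (i : 'I_n.+1) s : 0 < delta R i * a i (ord_pred i) s.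
Proof.
case: ha => _ _ neg pos; rewrite /delta; case: eqP => i0.
  by rewrite mulN1r oppr_gt0; exact: neg.
by rewrite mul1r; apply: pos; rewrite lt0n; exact/eqP.
Qed.

(** The entries are those of the combination of the columns of [Phi s] with coefficients [v], a
    solution by linearity. *)
Let is_derive_flow v (s : R) i : is_derive s 1 (fun s => (v *m (Phi s)^T) 0 i)
  (a i (ord_pred i) s * (v *m (Phi s)^T) 0 (ord_pred i) + a i i s * (v *m (Phi s)^T) 0 i).
Proof.
rewrite (_ : (fun s => _) = \sum_j (fun s => v 0 j * Phi s i j)); last first.
  by apply/funext => r; rewrite mxE fct_sumE; apply: eq_bigr => j _; rewrite mxE.
have dPhi j : is_derive s 1 (fun s => v 0 j * Phi s i j)
    (v 0 j * (a i (ord_pred i) s * Phi s (ord_pred i) j + a i i s * Phi s i j)).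
  have := hPhi.2 j s i; rewrite !mxE (_ : (fun s => _) = fun s => Phi s i j); last first.
    by apply/funext => r; rewrite mxE.
  by move=> dP; apply: is_derive_eq.
apply: (is_derive_eq (is_derive_sum dPhi)).
rewrite !mxE !mulr_sumr -big_split/=; apply: eq_bigr => j _; rewrite !mxE; ring.
Qed.

Let flow0 v : v *m (Phi 0)^T = v.
Proof. by rewrite hPhi.1 trmx1 mulmx1. Qed.

(** A kernel vector would start a nonzero solution that vanishes at time [t]. *)
Lemma fundamental_matrix_unit t : 0 <= t -> (Phi t)^T \in unitmx.
Proof.
move=> t0; rewrite unitmxE unitfE; apply/negP => /det0P[v v0 vt].
have := solution_neq0 (is_derive_flow v) diag_cont offdiag_cont (t := t).
by rewrite flow0 vt eqxx => /(_ v0 t0).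
Qed.

Lemma NM_le_Nm_fundamental t v : 0 < t -> v != 0 -> (NM (v *m (Phi t)^T) <= Nm v)%N.
Proof.
move=> t0 v0; rewrite -[v in leqRHS]flow0.
apply: (NM_le_Nm_flow (is_derive_flow v) diag_cont offdiag_cont delta_offdiag_gt0) => //.
by rewrite flow0.
Qed.

End FundamentalMatrix.

(* W i stands for W_(i+1): the index sets of W, nu, mu are shifted by one, so
   that 2h - 1 becomes (2 * h).+1.  Phi t acts on row vectors by
   x |-> x *m (Phi t)^T. *)
Theorem proposition2p12 (R : realType) (n : nat) (hn : (2 <= n)%N)
    (a : 'I_n -> 'I_n -> R -> R) (ha : cyclic_negative_feedback a)
    (Phi : R -> 'M[R]_n) (hPhi : fundamental_matrix a Phi)
    (t : R) (ht : 0 < t) :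
  let p := (ntilde n).+1./2 in
  exists W : 'I_p -> 'M[R]_n,
    (forall i, stablemx (W i) (Phi t)^T) /\
    (forall i : 'I_p, (i.+1 <= (ntilde n).-1./2)%N -> \rank (W i) = 2%N) /\
    (forall i : 'I_p, i.+1 = p -> \rank (W i) = (if odd n then 1 else 2)%N) /\
    mxdirect (\sum_i W i) /\
    (\sum_i W i == 1%:M)%MS /\
    (forall (i : 'I_p) (x : 'rV[R]_n), (x <= W i)%MS -> x != 0 ->
       calN x /\ extN x = (2 * i).+1) /\
    (forall (h k : 'I_p) (x : 'rV[R]_n), (h <= k)%N ->
       x != 0 -> (x <= \sum_(i : 'I_p | (h <= i <= k)%N) W i)%MS ->
       ((2 * h).+1 <= Nm x)%N /\ (NM x <= (2 * k).+1)%N) /\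
    exists nu mu : 'I_p -> R,
      (forall i, is_min_modulus (restrictmx (W i) (Phi t)^T) (nu i)) /\
      (forall i, is_max_modulus (restrictmx (W i) (Phi t)^T) (mu i)) /\
      (forall i, nu i <= mu i) /\
      (forall i j : 'I_p, (j : nat) = i.+1 -> mu j < nu i).
Proof.
case: n hn a ha Phi hPhi => // n hn a ha Phi hPhi.
apply: feedback_decomposition => //.
- exact: (fundamental_matrix_unit ha hPhi (ltW ht)).
- by move=> x; exact: (NM_le_Nm_fundamental ha hPhi ht).
Qed.
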